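(* Consider the Wasserstein distributionally robust problem described in the context, under the regularity assumption stated there. For $\rho\ge0$ let $$J^\star(\rho)=\min_{\boldsymbol x\in\mathcal X(\Xi)}\sup_{\mathbb Q\in\mathbb B_\rho(\hat{\mathbb P})}\mathbb E_{\mathbb Q}[\ell(\boldsymbol x,\tilde{\boldsymbol\xi})],\quad \overline J(\rho)=\min_{\boldsymbol x\in\widehat{\mathcal X}(\Xi)}\sup_{\mathbb Q\in\mathbb B_\rho(\hat{\mathbb P})}\mathbb E_{\mathbb Q}[\ell(\boldsymbol x,\tilde{\boldsymbol\xi})],\quad \underline J(\rho)=\max_{\mathbb Q\in\widehat{\mathcal B}(\hat{\mathbb P})\cap\mathbb B_\rho(\hat{\mathbb P})}\inf_{\boldsymbol x\in\mathcal X(\Xi)}\mathbb E_{\mathbb Q}[\ell(\boldsymbol x,\tilde{\boldsymbol\xi})]$$ be the optimal value, the a posteriori upper bound and the a posteriori lower bound, respectively. They satisfy: (i) (Monotonicity) All three values are nondecreasing in $\rho$. (ii) (Concavity) All three values are concave in $\rho$. (iii) (Endpoint tightness) $\overline J(\rho)=J^\star(\rho)=\underline J(\rho)$ at $\rho=0$ and for every $\rho\ge W(\hat{\mathbb P},\mathbb Q(\infty))$.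
   Context: Setting. $\mathcal X\subseteq\mathbb R^n$ is closed convex; the support $\Xi\subseteq\mathbb R^k$ is non-empty, closed and convex; the loss $\ell$ is closed convex in $\boldsymbol x$ for every $\boldsymbol\xi\in\Xi$ and upper semicontinuous in $\boldsymbol\xi$ for every $\boldsymbol x\in\mathcal X$; $g_m(\cdot,\boldsymbol\xi)$, $m\in[M]=\{1,\dots,M\}$, are closed convex for every $\boldsymbol\xi$, and $\gamma_m\in\mathbb R$. The feasible set is $\mathcal X(\Xi)=\{\boldsymbol x\in\mathcal X: g_m(\boldsymbol x,\boldsymbol\xi)\le\gamma_m\ \forall\boldsymbol\xi\in\Xi,\ \forall m\in[M]\}$, assumed non-empty. $\hat{\mathbb P}=\frac1N\sum_{i=1}^N\delta_{\hat{\boldsymbol\xi}_i}$ is the empirical distribution of samples $\hat{\boldsymbol\xi}_i\in\Xi$. $d$ is a lower semicontinuous ground metric, $W(\mathbb Q,\hat{\mathbb P})=\inf_{\pi\in\Pi(\mathbb Q,\hat{\mathbb P})}\int d(\boldsymbol\xi,\boldsymbol\xi')\,\pi(\mathrm d\boldsymbol\xi,\mathrm d\boldsymbol\xi')$ is the type-1 Wasserstein distance ($\Pi$ = couplings), $\mathcal P(\Xi)$ is the set of probability measures on $\Xi$, and $\mathbb B_\rho(\hat{\mathbb P})=\{\mathbb Q\in\mathcal P(\Xi):W(\mathbb Q,\hat{\mathbb P})\le\rho\}$. $\boldsymbol x(0)$ is a fixed optimal solution of the SAA problem $\min_{\boldsymbol x\in\mathcal X(\Xi)}\mathbb E_{\hat{\mathbb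 P}}[\ell(\boldsymbol x,\tilde{\boldsymbol\xi})]$ and $\boldsymbol x(\infty)$ a fixed optimal solution of the RO problem $\min_{\boldsymbol x\in\mathcal X(\Xi)}\sup_{\boldsymbol\xi\in\Xi}\ell(\boldsymbol x,\boldsymbol\xi)$; both problems are assumed to attain finite optimal values. The shrinkage path is $\widehat{\mathcal X}(\Xi)=\{(1-\lambda)\boldsymbol x(0)+\lambda\boldsymbol x(\infty):\lambda\in[0,1]\}$. Regularity assumption. (i) $\boldsymbol x\mapsto\mathbb E_{\hat{\mathbb P}}[\ell(\boldsymbol x,\tilde{\boldsymbol\xi})]$ is coercive on $\mathcal X$ (a function from $\mathcal X$ to $\mathbb R\cup\{+\infty\}$ is coercive if all its sublevel sets on $\mathcal X$ are bounded). (ii) There exist a neighborhood $\mathcal U$ of $\boldsymbol x(\infty)$ and a compact set $\mathcal K\subseteq\Xi$ such that $\sup_{\boldsymbol\xi\in\Xi}\ell(\boldsymbol x,\boldsymbol\xi)=\max_{\boldsymbol\xi\in\mathcal K}\ell(\boldsymbol x,\boldsymbol\xi)$ for all $\boldsymbol x\in\mathcal U\cap\mathcal X$. RO distribution and dual shrinkage path. $\mathbb Q(\infty)$ is any fixed element of $\arg\max_{\mathbb Q\in\mathcal P(\Xi)}\inf_{\boldsymbol x\in\mathcal X(\Xi)}\mathbb E_{\mathbb Q}[\ell(\boldsymbol x,\tilde{\boldsymbol\xi})]$ (under the regularity assumption such an optimizer exists and can be chosen to be supported on at most $n+1$ atoms). The dual shrinkage path is $\widehat{\mathcal B}(\hat{\mathbb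 P})=\{(1-\lambda)\hat{\mathbb P}+\lambda\mathbb Q(\infty):\lambda\in[0,1]\}$. *)

(* Defs.v *)
From HB Require Import structures.
From mathcomp Require Export all_boot all_order all_algebra.
From mathcomp Require Export all_classical all_reals all_analysis.

Set Implicit Arguments.
Unset Strict Implicit.
Unset Printing Implicit Defensive.

Export Order.TTheory GRing.Theory Num.Theory.
Export numFieldNormedType.Exports.


Local Open Scope classical_set_scope.
Local Open Scope ring_scope.
Local Open Scope ereal_scope.

(* R^k as a measurable space with its Borel sigma-algebra. The carrier is
   convertible to 'rV[R]_k. *)
Notation borelRV R k := (g_sigma_algebraType (@open 'rV[R]_k)).

Section convex_analysis.
Context {R : realType} {n : nat}.
Implicit Types (X : set 'rV[R]_n) (f : 'rV[R]_n -> \bar R).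

(* R^o carries the left R-module structure needed by convex_set. *)
Definition epigraph X f : set ('rV[R]_n * R^o) :=
  [set p | X p.1 /\ f p.1 <= p.2%:E].

(* f : X -> R \cup {+oo} is a closed convex function. *)
Definition closed_convex X f : Prop :=
  [/\ forall x, X x -> -oo < f x,
      closed (epigraph X f) & convex_set (epigraph X f)].

Definition coercive X f : Prop :=
  forall r : R, bounded_set [set x | X x /\ f x <= r%:E].

Definition optimal_solution X f (x : 'rV[R]_n) : Prop :=
  X x /\ forall y, X y -> f x <= f y.

Definition segment (x y : 'rV[R]_n) : set 'rV[R]_n :=
  range (fun l : {i01 R} => ((1 - l%:num) *: x + l%:num *: y)%R).

End convex_analysis.

Definition upper_semicontinuous {T : topologicalType} {R : numFieldType}
    (f : T -> \bar R) : Prop :=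
  forall x a, f x < a%:E -> exists2 V, nbhs x V & forall y, V y -> f y < a%:E.

Definition is_max {R : realType} (S : set (\bar R)) (m : \bar R) : Prop :=
  S m /\ ubound S m.

Section metric.
Context {R : realType} {T : Type}.

Definition is_metric (A : set T) (d : T -> T -> R) : Prop :=
  [/\ forall x y, A x -> A y -> (0 <= d x y)%R,
      forall x y, A x -> A y -> (d x y = 0)%R <-> x = y,
      forall x y, A x -> A y -> d x y = d y x &
      forall x y z, A x -> A y -> A z -> (d x z <= d x y + d y z)%R].

End metric.

Section empirical.
Context d {T : measurableType d} {R : realType} {N : nat}.
Variable xi : 'I_N.+1 -> T.

Definition empirical (A : set T) : \bar R :=
  (N.+1%:R^-1)%R%:E * \sum_(i < N.+1) \d_(xi i) A.

Let empiricalE : empirical =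
  mscale ((N.+1%:R^-1)%:nng)%R
    (msum (fun i => \d_(xi (inord i)) : {measure set T -> \bar R}) N.+1).
Proof.
apply/funext => A; rewrite /empirical /mscale/= /msum; congr (_ * _).
by apply: eq_bigr => i _; rewrite /= inord_val.
Qed.

Let empirical0 : empirical set0 = 0.
Proof. by rewrite empiricalE measure0. Qed.

Let empirical_ge0 A : 0 <= empirical A.
Proof. by rewrite empiricalE measure_ge0. Qed.

Let empirical_sigma_additive : semi_sigma_additive empirical.
Proof. by rewrite empiricalE; exact: measure_semi_sigma_additive. Qed.

HB.instance Definition _ := isMeasure.Build _ _ _ empirical
  empirical0 empirical_ge0 empirical_sigma_additive.

Let empiricalT : empirical setT = 1.
Proof.
rewrite /empirical (eq_bigr (fun=> 1)) => [|i _]; last by rewrite diracT.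
by rewrite sumEFin sumr_const card_ord -EFinM mulVf// pnatr_eq0.
Qed.

HB.instance Definition _ :=
  Measure_isProbability.Build _ _ _ empirical empiricalT.

End empirical.

Section mixture.
Context d {T : measurableType d} {R : realType}.
Variables (l : {i01 R}) (P Q : probability T R).

Definition mixture (A : set T) : \bar R :=
  (1 - l%:num)%R%:E * P A + (l%:num)%:E * Q A.

Let mixtureE : mixture =
  measure_add (mscale ((1 - l%:num)%:nng)%R P) (mscale (l%:num%:nng)%R Q).
Proof. by apply/funext => A; rewrite measure_addE. Qed.

Let mixture0 : mixture set0 = 0.
Proof. by rewrite /mixture !measure0 !mule0 adde0. Qed.

Let mixture_ge0 A : 0 <= mixture A.
Proof. by rewrite mixtureE; exact: measure_ge0. Qed.

Let mixture_sigma_additive : semi_sigma_additive mixture.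
Proof. by rewrite mixtureE; exact: measure_semi_sigma_additive. Qed.

HB.instance Definition _ := isMeasure.Build _ _ _ mixture
  mixture0 mixture_ge0 mixture_sigma_additive.

Let mixtureT : mixture setT = 1.
Proof.
by rewrite /mixture !probability_setT !mule1 -EFinD subrK.
Qed.

HB.instance Definition _ :=
  Measure_isProbability.Build _ _ _ mixture mixtureT.

End mixture.

Section wasserstein.
Context {R : realType} {k : nat}.
Let T := borelRV R k.
Implicit Types (P Q : probability T R) (Xi : set 'rV[R]_k).

Definition probabilities_on Xi : set (probability T R) := [set Q | Q Xi = 1].

Definition couplings P Q : set (probability (T * T)%type R) :=
  [set pi | forall A : set T, measurable A ->
     pi (A `*` setT) = P A /\ pi (setT `*` A) = Q A].

(* The ground metric is only meaningful on Xi, whence the domain of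
   integration. *)
Definition wasserstein Xi (d : 'rV[R]_k -> 'rV[R]_k -> R) P Q : \bar R :=
  ereal_inf [set \int[pi]_(z in Xi `*` Xi) (d z.1 z.2)%:E
            | pi in couplings P Q].

Definition wasserstein_ball Xi d P (rho : R) : set (probability T R) :=
  [set Q | probabilities_on Xi Q /\ wasserstein Xi d Q P <= rho%:E].

(* E_Q[f] for Q supported on Xi and f : Xi -> R \cup {+oo}. If both the positive
   and the negative part of f have infinite integral, the value is -oo, so that
   such a Q never contributes to a supremum over distributions. *)
Definition expect Xi Q (f : 'rV[R]_k -> \bar R) : \bar R :=
  \int[Q]_(xi in Xi) f xi.

Definition dual_path P Q : set (probability T R) :=
  range (fun l : {i01 R} => mixture l P Q : probability T R).

End wasserstein.

Section dro.
Context {R : realType} {n k : nat}.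
Let T := borelRV R k.
Variables (Xi : set 'rV[R]_k) (ell : 'rV[R]_n -> 'rV[R]_k -> \bar R).
Variable d : 'rV[R]_k -> 'rV[R]_k -> R.
Implicit Types (P Q : probability T R) (X : set 'rV[R]_n) (x : 'rV[R]_n).

Definition feasible X M (g : 'I_M -> 'rV[R]_n -> 'rV[R]_k -> \bar R)
    (gamma : 'I_M -> R) : set 'rV[R]_n :=
  [set x | X x /\ forall xi, Xi xi -> forall m, g m x xi <= (gamma m)%:E].

Definition worst_case x : \bar R := ereal_sup [set ell x xi | xi in Xi].

Definition dual_objective X Q : \bar R :=
  ereal_inf [set expect Xi Q (ell x) | x in X].

(* The optimal value J* is [primal_value X(Xi)]; the a posteriori upper bound is
   [primal_value] of the shrinkage path. *)
Definition primal_value X P (rho : R) : \bar R :=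
  ereal_inf [set ereal_sup [set expect Xi Q (ell x)
                           | Q in wasserstein_ball Xi d P rho] | x in X].

Definition lower_bound X P Q (rho : R) : \bar R :=
  ereal_sup [set dual_objective X B
            | B in dual_path P Q `&` wasserstein_ball Xi d P rho].

End dro.

Section radius_functions.
Context {R : realType}.
Implicit Type J : R -> \bar R.

Definition nondecreasing_radius J : Prop :=
  forall r s : R, (0 <= r)%R -> (r <= s)%R -> J r <= J s.

Definition concave_radius J : Prop :=
  forall r s t : R, (0 <= r)%R -> (0 <= s)%R -> (0 <= t <= 1)%R ->
    (1 - t)%R%:E * J r + t%:E * J s <= J ((1 - t) * r + t * s)%R.

End radius_functions.

(* Main.v *)
(** Monotonicity is inclusion of balls. Concavity: a mixture of couplings
    couples the mixtures, so the ball of radius [(1 - t) r + t s] contains the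
    mixtures of the balls of radii [r] and [s]; the expectation is affine along
    mixtures, and an infimum of concave functions is concave.

    At radius 0 the ball is the singleton of the empirical distribution. For a
    radius of at least [W(P, Q(oo))], both bounds sandwich the optimal value as
    soon as [inf_x E_Q(oo)[ell x]] is at least the robust value [v], that is,
    as soon as the robust problem has no duality gap. As [Q(oo)] is optimal, it
    is enough to find, for every [e > 0], a finitely supported [Q] with
    [E_Q[ell x] >= v - e] for all feasible [x]. Coercivity makes the set where
    all sampled losses are at most [t < v] compact, so finitely many scenarios,
    samples included, already have [max_j ell(x, xi_j) > t] everywhere. Adding
    the scenarios one by one, a minimax argument for two convex functions
    yields weights. Losses may be infinite, and a scenario of weight zero does
    not see where its loss is infinite; mixing in a small multiple of a
    distribution that charges all scenarios repairs this, provided its expected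
    loss is bounded below, which holds once enough of the empirical
    distribution is added. *)

Require Import Defs.
From HB Require Import structures.
From mathcomp Require Import measurable_realfun ring lra.

Set Implicit Arguments.
Unset Strict Implicit.
Unset Printing Implicit Defensive.

Local Open Scope classical_set_scope.
Local Open Scope ring_scope.
Local Open Scope ereal_scope.

(** * Integration *)

Section integral_without_measurability.
Context d (T : measurableType d) (R : realType).
Implicit Types (D : set T) (f g : T -> \bar R).

Import HBNNSimple.

(** The integral of a nonnegative function is by definition a supremum over the simple functions
    below it, measurable or not. Arguing on that supremum lets transport costs be compared without
    first proving [d] jointly measurable for the product sigma-algebra. *)
Lemma ge0_integral_ubound (mu : {measure set T -> \bar R}) D g (c : \bar R) :
  (forall x, D x -> 0 <= g x) ->
  (forall h : {nnsfun T >-> R}, (forall x, (h x)%:E <= (g \_ D) x) ->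
     \int[mu]_x (h x)%:E <= c) ->
  \int[mu]_(x in D) g x <= c.
Proof.
move=> g0 H; rewrite ge0_integralE//; apply: ge_ereal_sup => _ [h /= hg <-].
by move: (H h hg); rewrite integral_nnsfun// patch_setT.
Qed.

Lemma integral_nnsfun_le (mu : {measure set T -> \bar R}) D g
    (h : {nnsfun T >-> R}) :
  (forall x, D x -> 0 <= g x) -> (forall x, (h x)%:E <= (g \_ D) x) ->
  \int[mu]_x (h x)%:E <= \int[mu]_(x in D) g x.
Proof.
move=> g0 hg; rewrite [leRHS]ge0_integralE//; apply: ereal_sup_ubound.
by exists h => //; rewrite integral_nnsfun// patch_setT.
Qed.

Lemma ge0_le_integral_nomeas (mu : {measure set T -> \bar R}) D f g :
  (forall x, D x -> 0 <= f x) -> (forall x, D x -> f x <= g x) ->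
  \int[mu]_(x in D) f x <= \int[mu]_(x in D) g x.
Proof.
move=> f0 fg; have g0 x (Dx : D x) : 0 <= g x := le_trans (f0 x Dx) (fg x Dx).
apply: ge0_integral_ubound => // h hf; apply: integral_nnsfun_le => // x.
apply: le_trans (hf x) _; rewrite /patch; case: ifPn => // /set_mem.
exact: fg.
Qed.

Lemma le_integral_nomeas (mu : {measure set T -> \bar R}) D f g :
  (forall x, D x -> f x <= g x) ->
  \int[mu]_(x in D) f x <= \int[mu]_(x in D) g x.
Proof.
move=> fg; rewrite integralE [leRHS]integralE; apply: leeB.
- apply: ge0_le_integral_nomeas => x Dx; first by rewrite funepos_ge0.
  by rewrite !funeposE ge_max !le_max fg// lexx orbT.
- apply: ge0_le_integral_nomeas => x Dx; first by rewrite funeneg_ge0.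
  by rewrite !funenegE ge_max !le_max leeN2 fg// lexx orbT.
Qed.

Lemma mixture_measure_add (l : {i01 R}) (P Q : probability T R) (A : set T) :
  mixture l P Q A = (measure_add (mscale (1 - l%:num)%:nng%R P)
    (mscale l%:num%:nng%R Q)) A.
Proof. by rewrite measure_addE. Qed.

(** A simple function below [g] is integrated exactly against the mixture, and each of the two
    resulting integrals is at most that of [g]. *)
Lemma ge0_integral_mixture_le (l : {i01 R}) (P Q : probability T R) D g :
  (forall x, D x -> 0 <= g x) ->
  \int[mixture l P Q]_(x in D) g x <=
  (1 - l%:num)%R%:E * \int[P]_(x in D) g x + l%:num%:E * \int[Q]_(x in D) g x.
Proof.
move=> g0; apply: ge0_integral_ubound => // h hg.
have mh : measurable_fun setT (EFin \o h) by exact/measurable_EFinP.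
have h0 x : setT x -> 0 <= (h x)%:E by rewrite lee_fin.
have -> : \int[mixture l P Q]_x (h x)%:E =
    (1 - l%:num)%R%:E * \int[P]_x (h x)%:E + l%:num%:E * \int[Q]_x (h x)%:E.
  rewrite (eq_measure_integral (measure_add (mscale (1 - l%:num)%:nng%R P)
    (mscale l%:num%:nng%R Q))); last by move=> A _ _; exact: mixture_measure_add.
  by rewrite ge0_integral_measure_add// !ge0_integral_mscale.
by apply: leeD; apply: lee_wpmul2l; rewrite ?lee_fin//;
  exact: integral_nnsfun_le.
Qed.

Lemma ge0_integral_mixture (l : {i01 R}) (P Q : probability T R) D g :
  measurable D -> measurable_fun D g -> (forall x, D x -> 0 <= g x) ->
  \int[mixture l P Q]_(x in D) g x =
  (1 - l%:num)%R%:E * \int[P]_(x in D) g x + l%:num%:E * \int[Q]_(x in D) g x.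
Proof.
move=> mD mg g0.
rewrite (eq_measure_integral (measure_add (mscale (1 - l%:num)%:nng%R P)
  (mscale l%:num%:nng%R Q))); last by move=> A _ _; exact: mixture_measure_add.
by rewrite ge0_integral_measure_add// !ge0_integral_mscale.
Qed.

End integral_without_measurability.

Section integral_pushforward_nomeas.
Context d1 d2 (T1 : measurableType d1) (T2 : measurableType d2) (R : realType).
Import HBNNSimple.

(** A simple function below [g] becomes, after composition with [phi], a simple function below
    [g \o phi]. Simple functions below [g \o phi] need not factor through [phi], whence an
    inequality. *)
Lemma ge0_integral_pushforward_le (mu : {measure set T1 -> \bar R})
    (phi : T1 -> T2) (D : set T2) (g : T2 -> \bar R) :
  measurable_fun setT phi -> (forall x, D x -> 0 <= g x) ->
  \int[pushforward mu phi]_(y in D) g y <=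
  \int[mu]_(x in phi @^-1` D) g (phi x).
Proof.
move=> mphi g0; apply: ge0_integral_ubound => // h hg.
rewrite ge0_integral_pushforward//; last 2 first.
- exact/measurable_EFinP.
- by move=> y _; rewrite lee_fin.
rewrite preimage_setT [leRHS]integral_mkcond; apply: ge0_le_integral_nomeas.
- by move=> x _; rewrite lee_fin.
- by move=> x _; exact: hg.
Qed.

End integral_pushforward_nomeas.

(** * Expectations under mixtures and empirical distributions *)

Section expectation.
Context d (T : measurableType d) (R : realType).
Implicit Types (D : set T) (f g : T -> \bar R).

(** For [r > 0] and [a = b = +oo] both sides are [-oo], the default value of [+oo - +oo]; for
    [r = 0] both vanish. *)
Lemma muleBr_ge0 (r : R) (a b : \bar R) : (0 <= r)%R -> 0 <= a -> 0 <= b ->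
  r%:E * (a - b) = r%:E * a - r%:E * b.
Proof.
rewrite le_eqVlt => /predU1P[<-|r0]; first by rewrite !mul0e subee.
move: a b => [a| |] [b| |]// a0 b0; rewrite ?(gt0_muley, gt0_muleNy, lte_fin)//.
all: rewrite -?EFinM -?EFinB ?mulrBr//=.
all: by rewrite ?gt0_muley ?gt0_muleNy ?lte_fin.
Qed.

(** Positive and negative parts may be regrouped even when an expectation is undefined: [-oo]
    absorbs in sums, and a zero weight annihilates it. *)
Lemma integral_mixture (l : {i01 R}) (P Q : probability T R) D f :
  measurable D -> measurable_fun D f ->
  \int[mixture l P Q]_(x in D) f x =
  (1 - l%:num)%R%:E * \int[P]_(x in D) f x + l%:num%:E * \int[Q]_(x in D) f x.
Proof.
move=> mD mf; rewrite integralE [in X in _ = X + _]integralE.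
rewrite [in X in _ = _ + X]integralE.
rewrite !ge0_integral_mixture//; last 2 first.
- exact: measurable_funeneg.
- exact: measurable_funepos.
have pos (P' : probability T R) : 0 <= \int[P']_(x in D) (f^\+ x).
  exact: integral_ge0.
have neg (P' : probability T R) : 0 <= \int[P']_(x in D) (f^\- x).
  exact: integral_ge0.
have l1 : (0 <= 1 - l%:num)%R by [].
move: (pos P) (pos Q) (neg P) (neg Q).
set a := \int[P]_(x in D) f^\+ x; set a' := \int[Q]_(x in D) f^\+ x.
set b := \int[P]_(x in D) f^\- x; set b' := \int[Q]_(x in D) f^\- x.
move: a a' b b' => a a' b b' a0 a'0 b0 b'0.
rewrite !muleBr_ge0// oppeD; first by rewrite addeACA.
by apply: ge0_adde_def; rewrite inE mule_ge0// lee_fin.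
Qed.

Lemma integral_le_cst (P : probability T R) D f (c : \bar R) :
  measurable D -> P D = 1 -> (forall x, D x -> f x <= c) ->
  \int[P]_(x in D) f x <= c.
Proof.
move=> mD PD fc; apply: (@le_trans _ _ (\int[P]_(x in D) cst c x)).
  exact: le_integral_nomeas.
by rewrite integral_cst// [X in _ * X]PD mule1.
Qed.

Lemma integral_empirical N (xi : 'I_N.+1 -> T) D f :
  measurable D -> measurable_fun D f -> (forall i, D (xi i)) ->
  (forall i, -oo < f (xi i)) ->
  \int[empirical xi]_(x in D) f x =
  (N.+1%:R^-1)%R%:E * \sum_(i < N.+1) f (xi i).
Proof.
move=> mD mf Dxi fy.
have ge0E (h : T -> \bar R) : measurable_fun D h ->
    (forall x, D x -> 0 <= h x) ->
    \int[empirical xi]_(x in D) h x =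
    (N.+1%:R^-1)%R%:E * \sum_(i < N.+1) h (xi i).
  move=> mh h0.
  transitivity (\int[mscale ((N.+1%:R^-1)%:nng)%R
      (msum (fun i => \d_(xi (inord i)) : {measure set T -> \bar R})
        N.+1)]_(x in D) h x).
    apply: eq_measure_integral => A _ _; rewrite /= /empirical /mscale/= /msum.
    by congr (_ * _); apply: eq_bigr => i _; rewrite /= inord_val.
  rewrite ge0_integral_mscale//= ge0_integral_measure_sum//; congr (_ * _).
  apply: eq_bigr => i _; rewrite integral_dirac// inord_val.
  by rewrite diracE mem_set ?mul1e.
rewrite integralE !ge0E//; last 2 first.
- exact: measurable_funeneg.
- exact: measurable_funepos.
rewrite -muleBr_ge0 ?invr_ge0// ?sume_ge0//; congr (_ * _).
rewrite -sumeN; last first.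
  by move=> i j _ _; apply: ge0_adde_def; rewrite inE.
rewrite -big_split/=; apply: eq_bigr => i _.
by rewrite [in RHS](funeposneg f).
Qed.

End expectation.

(** * Wasserstein distance *)

Section borel.
Context {R : realType} {k : nat}.

Lemma closed_measurable_borelRV (A : set 'rV[R]_k) :
  closed A -> measurable (A : set (borelRV R k)).
Proof.
move=> /closed_openC oA; rewrite -(setCK A); apply: measurableC.
exact: sub_sigma_algebra.
Qed.

Lemma measurable1_borelRV (x : 'rV[R]_k) :
  measurable ([set x] : set (borelRV R k)).
Proof.
apply: closed_measurable_borelRV.
exact/accessible_closed_set1/hausdorff_accessible/norm_hausdorff.
Qed.

(** The sets [f < a] generate, and upper semicontinuity makes them relatively open in [D], hence
    traces on [D] of open sets. *)
Lemma usc_measurable_borelRV (D : set 'rV[R]_k) (f : 'rV[R]_k -> \bar R) :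
  @upper_semicontinuous (subspace D) R f ->
  measurable_fun (D : set (borelRV R k)) f.
Proof.
move=> usc mD; apply: (measurability _ (ErealGenInftyO.measurableE R)) => //.
move=> /= _ [_ [a ->]] <-.
have : open ([set x | f x < a%:E] : set (subspace D)).
  rewrite openE => x /= /usc[V xV Vf]; rewrite /interior.
  by apply: filterS xV => y /Vf.
move=> /open_subspaceP[V oV VD].
rewrite [X in measurable X](_ : _ = D `&` V).
  by apply: measurableI => //; exact: sub_sigma_algebra.
by rewrite [RHS]setIC VD [LHS]setIC.
Qed.

End borel.

Section wasserstein_theory.
Context {R : realType} {k : nat}.
Let T := borelRV R k.
Variables (Xi : set 'rV[R]_k) (d : 'rV[R]_k -> 'rV[R]_k -> R).
Hypothesis d_metric : is_metric Xi d.
Implicit Types P Q : probability T R.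

Let d_ge0 (z : T * T) : (Xi `*` Xi) z -> 0 <= (d z.1 z.2)%:E.
Proof. by case: d_metric => + _ _ _ [z1 z2]; rewrite lee_fin; exact. Qed.

Lemma wasserstein_lt P Q (r : \bar R) : wasserstein Xi d P Q < r ->
  exists2 pi, couplings P Q pi &
    \int[pi]_(z in Xi `*` Xi) (d z.1 z.2)%:E < r.
Proof. by move=> /ereal_inf_lt[_ [pi ? <-] ?]; exists pi. Qed.

Lemma le_wasserstein P Q pi : couplings P Q pi ->
  wasserstein Xi d P Q <= \int[pi]_(z in Xi `*` Xi) (d z.1 z.2)%:E.
Proof. by move=> Cpi; apply: ereal_inf_lbound; exists pi. Qed.

(** Probabilities are functions of arbitrary sets, so agreement on measurable sets is weaker than
    equality and has to be transported explicitly. *)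
Lemma wasserstein_eql P P' Q : (forall A, measurable A -> P A = P' A) ->
  wasserstein Xi d P Q = wasserstein Xi d P' Q.
Proof.
move=> PP'; congr (ereal_inf (image _ _)); apply/seteqP.
by split=> pi Cpi A mA; have [PA QA] := Cpi A mA; split=> //;
  rewrite PA PP'.
Qed.

Lemma wasserstein_mixture (l : {i01 R}) Q1 Q2 P (r s : R) :
  wasserstein Xi d Q1 P <= r%:E -> wasserstein Xi d Q2 P <= s%:E ->
  wasserstein Xi d (mixture l Q1 Q2) P <= ((1 - l%:num) * r + l%:num * s)%:E.
Proof.
move=> W1 W2; apply/lee_addgt0Pr => e e0.
(* The infima are not known to be attained, so couplings within [e] of them are mixed. *)
have [|pi1 C1 I1] := @wasserstein_lt Q1 P (r + e)%:E.
  by apply: le_lt_trans W1 _; rewrite lte_fin ltrDl.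
have [|pi2 C2 I2] := @wasserstein_lt Q2 P (s + e)%:E.
  by apply: le_lt_trans W2 _; rewrite lte_fin ltrDl.
apply: le_trans (@le_wasserstein _ _ (mixture l pi1 pi2) _) _.
  move=> A mA; have [Q1A P1A] := C1 A mA; have [Q2A P2A] := C2 A mA.
  split; first by rewrite /= /mixture Q1A Q2A.
  rewrite /= /mixture P1A P2A -ge0_muleDl ?lee_fin//.
  by rewrite -EFinD subrK mul1e.
apply: le_trans (ge0_integral_mixture_le _ _ _ d_ge0) _.
have -> : ((1 - l%:num) * r + l%:num * s)%:E + e%:E =
    (1 - l%:num)%:E * (r + e)%:E + l%:num%:E * (s + e)%:E.
  by rewrite -!EFinM -!EFinD; congr EFin; ring.
by apply: leeD; apply: lee_wpmul2l; rewrite ?lee_fin//; exact: ltW.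
Qed.

(** Exchanging the coordinates of a coupling preserves its cost. This reconciles the balls, which
    measure from [Q] to the centre, with the threshold on the radius, which measures from the centre
    to the robust distribution. *)
Lemma wasserstein_sym_le P Q : wasserstein Xi d P Q <= wasserstein Xi d Q P.
Proof.
apply: le_ereal_inf_tmp => _ [pi Cpi <-].
pose swap (z : T * T) := (z.2, z.1).
have mswap : measurable_fun setT swap by exact: measurable_swap.
pose sw : {mfun (T * T)%type >-> (T * T)%type} :=
  HB.pack swap (isMeasurableFun.Build _ _ _ _ _ mswap).
pose pi' : probability (T * T)%type R := distribution pi sw.
apply: le_trans (@le_wasserstein _ _ pi' _) _.
  move=> A mA; have [QA PA] := Cpi A mA; rewrite -PA -QA.
  by split; congr (pi _); apply/seteqP; split=> -[x y] [].
apply: le_trans (ge0_integral_pushforward_le _ mswap d_ge0) _.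
have [_ _ dC _] := d_metric.
rewrite (_ : swap @^-1` (Xi `*` Xi) = Xi `*` Xi).
  by apply: le_integral_nomeas => -[x y] [/= ? ?]; rewrite lee_fin dC.
by apply/seteqP; split=> -[x y] [].
Qed.

End wasserstein_theory.

(** The inequality for the complement gives the converse, both total masses being one. *)
Lemma probability_le_eq d (T : measurableType d) (R : realType)
    (P Q : probability T R) :
  (forall A, measurable A -> P A <= Q A) ->
  forall A, measurable A -> P A = Q A.
Proof.
move=> PQ A mA; apply/eqP; rewrite eq_le PQ//=.
have := PQ _ (measurableC mA); rewrite !probability_setC//.
rewrite -(fineK (fin_num_measure P A mA)) -(fineK (fin_num_measure Q A mA)).
by rewrite -!EFinB !lee_fin lerD2l lerN2.
Qed.

(** * Distributions at distance zero from the empirical one *)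

Section wasserstein_empirical.
Context {R : realType} {k N : nat}.
Let T := borelRV R k.
Variables (Xi : set 'rV[R]_k) (d : 'rV[R]_k -> 'rV[R]_k -> R).
Variable xi : 'I_N.+1 -> T.
Hypothesis d_metric : is_metric Xi d.
Hypothesis closed_Xi : closed Xi.
Hypothesis Xi_xi : forall i, Xi (xi i).
Hypothesis d_lsc : lower_semicontinuous
    (fun z : subspace (Xi `*` Xi) => (d z.1 z.2)%:E : \bar R).
Implicit Types P Q : probability T R.

Let d_ge0 (z : T * T) : (Xi `*` Xi) z -> 0 <= (d z.1 z.2)%:E.
Proof. by case: d_metric => + _ _ _ [z1 z2]; rewrite lee_fin; exact. Qed.

Let mXi : measurable (Xi : set T).
Proof. exact: closed_measurable_borelRV. Qed.

(** The diagonal coupling has cost zero. *)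
Lemma wasserstein_refl P : wasserstein Xi d P P <= 0.
Proof.
pose diag (x : T) : T * T := (x, x).
have mdiag : measurable_fun setT diag by exact: measurable_fun_pair.
pose dg : {mfun T >-> (T * T)%type} :=
  HB.pack diag (isMeasurableFun.Build _ _ _ _ _ mdiag).
pose pi : probability (T * T)%type R := distribution P dg.
apply: le_trans (@le_wasserstein _ _ _ _ _ _ pi _) _.
  by move=> A mA; split; congr (P _); apply/seteqP; split=> x // [].
apply: le_trans (ge0_integral_pushforward_le _ mdiag d_ge0) _.
have [_ d0 _ _] := d_metric.
by rewrite integral0_eq// => x [Xx _]; congr EFin; apply/d0.
Qed.

(** Fixing the second argument at [a] in the joint lower semicontinuity shows that the complement of
    the ball is relatively open in [Xi]. *)
Lemma measurable_closed_ball_metric (a : T) (e : R) : Xi a ->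
  measurable ([set x | Xi x /\ (d x a <= e)%R] : set T).
Proof.
move=> Xa.
have : open ([set x | (e < d x a)%R] : set (subspace Xi)).
  apply/open_subspaceP.
  exists (interior [set x | Xi x -> (e < d x a)%R]); first exact: open_interior.
  apply/seteqP; split=> x /= [].
    by move=> /interior_subset + Xx => /(_ Xx).
  move=> ex Xx; split=> //.
  have := d_lsc (x := (x, a)) (a := e); rewrite lte_fin => /(_ ex)[V xV Ve].
  move: xV; rewrite /nbhs/= /nbhs_subspace/=.
  rewrite mem_set// => -[[U W] /= [xU aW] UWV].
  rewrite /interior; apply: filterS xU => y Uy Xy.
  have : V (y, a) by apply: UWV => //; split=> //=; exact: nbhs_singleton.
  by move=> /Ve; rewrite lte_fin.
move=> /open_subspaceP[V oV VXi].
rewrite [X in measurable X](_ : _ = Xi `\` V).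
  by apply: measurableD => //; exact: sub_sigma_algebra.
apply/seteqP; split=> x /= [Xx].
  move=> dxa; split=> // Vx.
  have : ([set x | (e < d x a)%R] `&` Xi) x by rewrite -VXi.
  by move=> [/=]; rewrite ltNge dxa.
move=> Vx; split=> //; rewrite leNgt; apply/negP => edx; apply: Vx.
have : ([set x | (e < d x a)%R] `&` Xi) x by [].
by rewrite -VXi => -[].
Qed.

Let mtimes (A B : set T) : measurable A -> measurable B ->
  measurable (A `*` B : set (T * T)).
Proof. exact: measurableX. Qed.

(** Mass lying here can be moved to a different sample at low cost, so Markov's inequality does not
    control it. The set shrinks to the empty one as [e] tends to zero. *)
Let close (e : R) : set T :=
  \bigcup_(i in [set: 'I_N.+1]) ([set x | Xi x /\ (d x (xi i) <= e)%R] `\ xi i).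

Let mclose e : measurable (close e).
Proof.
apply: fin_bigcup_measurable => // i _; apply: measurableD.
  exact: measurable_closed_ball_metric.
exact: measurable1_borelRV.
Qed.

(** Almost surely [x] is in [Xi] and [y] is a sample. Then either [x = y], or [x] is in [close e],
    or the pair is at distance more than [e]; the last event is [G]. *)
Let le_measure_coupling Q pi (e : R) (A : set T) :
  Q Xi = 1 -> couplings Q (empirical xi) pi -> (0 < e)%R -> measurable A ->
  Q A <= empirical xi A + Q (close e) +
         (e^-1)%R%:E * \int[pi]_(z in Xi `*` Xi) (d z.1 z.2)%:E.
Proof.
move=> QXi Cpi e0 mA.
pose G : set (T * T) :=
  \bigcup_(i in [set: 'I_N.+1]) ((Xi `\` close e `\ xi i) `*` [set xi i]).
have mG : measurable G.
  apply: fin_bigcup_measurable => // i _; apply: mtimes.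
    by apply: measurableD; [exact: measurableD|exact: measurable1_borelRV].
  exact: measurable1_borelRV.
have GX : G `<=` Xi `*` Xi by move=> [x y] [i _] [/= [[? _] _] ->].
(* Markov's inequality: the cost exceeds [e] on [G]. *)
have piG : pi G <= (e^-1)%R%:E * \int[pi]_(z in Xi `*` Xi) (d z.1 z.2)%:E.
  rewrite lee_pdivlMl//.
  have mXX : measurable (Xi `*` Xi : set (T * T)) by exact: mtimes.
  rewrite -(setIidl GX) -integral_indic//.
  rewrite -ge0_integralZl_EFin//; last 2 first.
  - exact/measurable_EFinP/measurable_indic.
  - exact: ltW.
  apply: le_integral_nomeas => z Xz; rewrite -EFinM lee_fin indicE.
  case: (boolP (z \in G)) => [/set_mem|_]; last first.
    by rewrite mulr0 -lee_fin d_ge0.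
  move: z Xz => [x y] [/= Xx Xy] [i _] [/= [[_ ncx] xxi] ->]; rewrite mulr1 leNgt.
  by apply/negP => /ltW dxe; apply: ncx; exists i.
pose atoms : set T := range xi.
have matoms : measurable atoms.
  rewrite (_ : atoms = \bigcup_(i in [set: 'I_N.+1]) [set xi i]).
    by apply: fin_bigcup_measurable => // i _; exact: measurable1_borelRV.
  by apply/seteqP; split=> x [i _]; [move=> <-|move=> ->]; exists i.
have natoms : pi (setT `*` ~` atoms) = 0.
  have [_ ->] := Cpi _ (measurableC matoms).
  rewrite /= /empirical big1 ?mule0// => i _; rewrite diracE memNset//=.
  by apply; exists i.
have nXi : pi (~` Xi `*` setT) = 0.
  have [-> _] := Cpi _ (measurableC mXi).
  by rewrite probability_setC// QXi subee.
have [QA _] := Cpi A mA; have [_ PA] := Cpi A mA.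
have [Qclose _] := Cpi _ (mclose e).
rewrite -QA -PA -Qclose.
have sub : A `*` setT `<=` (setT `*` A) `|` (close e `*` setT) `|` G `|`
    (setT `*` ~` atoms `|` ~` Xi `*` setT).
  move=> [x y] [/= Ax _].
  have [Xx|nXx] := pselect (Xi x); last by right; right.
  have [[i _ yi]|ny] := pselect (atoms y); last by right; left.
  left; have [cx|ncx] := pselect (close e x); first by left; right.
  have [xy|xy] := pselect (x = y); first by left; left; split=> //=; rewrite -xy.
  by right; exists i => //; split=> //=; split=> //; rewrite yi.
have mA1 : measurable (A `*` setT : set (T * T)) by exact: mtimes.
have mA2 : measurable (setT `*` A : set (T * T)) by exact: mtimes.
have mC : measurable (close e `*` setT : set (T * T)) by exact: mtimes.
have mn1 : measurable (setT `*` ~` atoms : set (T * T)).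
  by apply: mtimes => //; exact: measurableC.
have mn2 : measurable (~` Xi `*` setT : set (T * T)).
  by apply: mtimes => //; exact: measurableC.
apply: le_trans (le_measure pi _ _ sub) _.
- by rewrite inE.
- by rewrite inE; do ?apply: measurableU.
have U2 (B C : set (T * T)) : measurable B -> measurable C ->
    pi (B `|` C) <= pi B + pi C by exact: measureU2.
have mAC := measurableU _ _ mA2 mC; have mACG := measurableU _ _ mAC mG.
apply: le_trans (U2 _ _ mACG (measurableU _ _ mn1 mn2)) _.
rewrite -[leRHS]adde0; apply: leeD; last first.
  by apply: le_trans (U2 _ _ mn1 mn2) _; rewrite natoms nXi adde0.
apply: le_trans (U2 _ _ mAC mG) _; apply: leeD => //; exact: U2.
Qed.

Let le_measure_wasserstein0 Q (A : set T) :
  Q Xi = 1 -> wasserstein Xi d Q (empirical xi) <= 0 -> measurable A ->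
  Q A <= empirical xi A.
Proof.
move=> QXi W0 mA.
(* A coupling of cost below [e * c] makes the Markov term at most [c], which is arbitrary. *)
have step (e : R) : (0 < e)%R -> Q A <= empirical xi A + Q (close e).
  move=> e0; apply/lee_addgt0Pr => c c0.
  have [|pi Cpi Ipi] := @wasserstein_lt _ _ Xi d Q (empirical xi) (e * c)%:E.
    by apply: le_lt_trans W0 _; rewrite lte_fin mulr_gt0.
  apply: le_trans (le_measure_coupling QXi Cpi e0 mA) _.
  by rewrite leeD2l// lee_pdivrMl// -EFinM ltW.
pose F j := close (j.+1%:R^-1).
have capF : \bigcap_j F j = set0.
  apply/seteqP; split=> // x Fx.
  have [d_nneg d0 _ _] := d_metric.
  have [i0 _ [[Xx _] _]] := Fx 0%N Logic.I.
  (* There are finitely many samples, so one threshold lies below the distances from [x] to all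
     samples other than [x]. *)
  have [j hj] : exists j : nat, forall i, x <> xi i -> (j.+1%:R^-1 < d x (xi i))%R.
    have pick i : exists j : nat, x <> xi i -> (j.+1%:R^-1 < d x (xi i))%R.
      have [xxi|xxi] := pselect (x = xi i); first by exists 0%N.
      have d_gt0 : (0 < d x (xi i))%R.
        rewrite lt_def d_nneg// andbT; apply/eqP => /d0 xE; apply: xxi.
        exact: xE.
      have := near_infty_natSinv_lt (PosNum d_gt0).
      by move=> [j _ /(_ j (leqnn j))/= jd]; exists j.
    have [J HJ] := choice pick.
    exists (\max_(i < N.+1) J i)%N => i /HJ; apply: le_lt_trans.
    by rewrite lef_pV2 ?posrE// ler_nat ltnS leq_bigmax.
  have [i _ [[_ dx] xxi]] := Fx j Logic.I.
  by have := hj i xxi; rewrite ltNge dx.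
have cvgF : Q \o F @ \oo --> 0.
  rewrite -(measure0 Q) -capF; apply: nonincreasing_cvg_mu => //.
  - by rewrite ltey_eq fin_num_measure ?orbT//; exact: mclose.
  - by move=> j; exact: mclose.
  - by rewrite capF.
  - move=> m n mn; apply/subsetPset => x [i _ [[Xx dx] xxi]]; exists i => //.
    split=> //; split=> //; apply: le_trans dx _.
    by rewrite lef_pV2 ?posrE// ler_nat ltnS.
have fP := fin_num_measure (empirical xi : probability T R) A mA.
rewrite -sube_le0; apply: cvge_to_ge cvgF _; apply: nearW => j /=.
rewrite leeBlDl; last exact: fP.
by apply: step; rewrite invr_gt0.
Qed.

(* The cost may induce a topology unrelated to the Euclidean one, so this does
   not follow from weak convergence: a coupling of small cost must leave most
   of the mass of Q exactly on the atoms. *)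
Lemma wasserstein_empirical_eq0 Q (A : set T) :
  Q Xi = 1 -> wasserstein Xi d Q (empirical xi) <= 0 -> measurable A ->
  Q A = empirical xi A.
Proof.
move=> QXi W0 mA; apply: (@probability_le_eq _ T R Q (empirical xi)) => // B mB.
exact: le_measure_wasserstein0.
Qed.

End wasserstein_empirical.

(** * Minimax for convex functions *)

Section minimax.
Context {R : realType} {V : lmodType R}.
Implicit Types (S Y : set V) (x y : V).

Definition plain_convex_set S := forall x y (s : R), S x -> S y ->
  (0 <= s <= 1)%R -> S ((1 - s) *: x + s *: y)%R.

Definition plain_convex_fun S (f : V -> R) := forall x y (s : R), S x -> S y ->
  (0 <= s <= 1)%R ->
  (f ((1 - s) *: x + s *: y) <= (1 - s) * f x + s * f y)%R.

Definition econvex_fun S (f : V -> \bar R) := forall x y (s : R), S x -> S y ->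
  (0 <= s <= 1)%R ->
  f ((1 - s) *: x + s *: y)%R <= (1 - s)%R%:E * f x + s%:E * f y.

Local Open Scope ring_scope.

(** A multiplier [mu >= 0] with [mu * (f - t) + (g - t) >= 0] is sought. Points where [f < t] bound
    it from above and points where [g <= t] from below; convexity makes these bounds compatible. *)
Lemma minimax_two S (f g : V -> R) (t : R) :
  plain_convex_set S -> plain_convex_fun S f -> plain_convex_fun S g ->
  (forall x, S x -> t <= f x \/ t < g x) ->
  exists l : R, 0 <= l <= 1 /\
    forall x, S x -> t <= (1 - l) * f x + l * g x.
Proof.
move=> Sc fc gc fg.
have [Ane|A0] := pselect (exists2 x0, S x0 & f x0 < t); last first.
  exists 0; split=> [|x Sx]; first by rewrite lexx ler01.
  rewrite subr0 mul1r mul0r addr0 leNgt; apply/negP => fx; apply: A0.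
  by exists x.
have gA x : S x -> f x < t -> t < g x.
  by move=> Sx fx; case: (fg x Sx) => //; rewrite leNgt fx.
have fB y : S y -> g y <= t -> t <= f y.
  by move=> Sy gy; case: (fg y Sy) => //; rewrite ltNge gy.
have key x y : S x -> S y -> f x < t -> g y <= t ->
    (t - f x) * (t - g y) <= (f y - t) * (g x - t).
  move=> Sx Sy fx gy; rewrite leNgt; apply/negP => H.
  have gx := gA _ Sx fx; have fy := fB _ Sy gy.
  set a := t - f x in H; set b := g x - t in H.
  set a' := f y - t in H; set b' := t - g y in H.
  have a0 : 0 < a by rewrite subr_gt0.
  have b0 : 0 < b by rewrite subr_gt0.
  have a'0 : 0 <= a' by rewrite subr_ge0.
  have b'0 : 0 <= b' by rewrite subr_ge0.
  have bb : 0 < b + b' by lra.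
  (* At this point of the segment the convexity bound for [g] equals [t], while the one for [f]
     falls below [t] if [key] fails. *)
  pose s := b / (b + b').
  have sE : 1 - s = b' / (b + b') by rewrite /s; field; lra.
  have s01 : 0 <= s <= 1.
    by apply/andP; split; [apply: divr_ge0|rewrite ler_pdivrMr]; lra.
  have Sz := Sc _ _ _ Sx Sy s01.
  have := fc _ _ _ Sx Sy s01; have := gc _ _ _ Sx Sy s01; rewrite sE.
  have -> : b' / (b + b') * f x + s * f y =
            t + (a' * b - a * b') / (b + b').
    by rewrite /s /a /a' /b /b'; field; rewrite /b /b' in bb; lra.
  have -> : b' / (b + b') * g x + s * g y = t.
    by rewrite /s /b /b'; field; rewrite /b /b' in bb; lra.
  have : (a' * b - a * b') / (b + b') < 0.
    by rewrite pmulr_llt0 ?invr_gt0// subr_lt0.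
  rewrite sE in Sz; case: (fg _ Sz) => ? ? ? ?; lra.
have [x0 Sx0 fx0] := Ane.
(* The lower bounds on [mu]; adding [0] makes the set nonempty and its supremum nonnegative. If
   [f y = t] the quotient is [0] by convention, which is harmless because [key] then forces
   [g y = t]. *)
pose B := [set r | r = 0 \/ exists y, [/\ S y, g y <= t &
                     r = (t - g y) / (f y - t)]].
have Bub x : S x -> f x < t -> ubound B ((g x - t) / (t - f x)).
  move=> Sx fx _ [->|[y [Sy gy ->]]].
    by rewrite divr_ge0// subr_ge0 ltW// gA.
  rewrite ler_pdivlMr ?subr_gt0//.
  have := key _ _ Sx Sy fx gy; have := fB _ Sy gy.
  rewrite -subr_ge0 le_eqVlt => /predU1P[<-|fy K].
    by rewrite invr0 mulr0 !mul0r => _; rewrite subr_ge0 ltW// gA.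
  by rewrite mulrAC ler_pdivrMr// mulrC [leRHS]mulrC.
have B0 : B 0 by left.
have hsB : has_sup B.
  by split; [exists 0|exists ((g x0 - t) / (t - f x0)); exact: Bub].
pose mu := sup B.
have mu0 : 0 <= mu by apply: ub_le_sup => //; case: hsB.
have muA x : S x -> f x < t -> mu * (t - f x) <= g x - t.
  move=> Sx fx; rewrite -ler_pdivlMr ?subr_gt0//; apply: ge_sup.
    by exists 0.
  exact: Bub.
have muB y : S y -> g y <= t -> t - g y <= mu * (f y - t).
  move=> Sy gy; have := fB _ Sy gy; rewrite -subr_ge0 le_eqVlt.
  move=> /predU1P[fy|fy].
    have := key _ _ Sx0 Sy fx0 gy; rewrite -fy mul0r mulr0.
    by rewrite pmulr_rle0 ?subr_gt0.
  rewrite -ler_pdivrMr//; apply: ub_le_sup; first by case: hsB.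
  by right; exists y.
(* The weights [mu] of [f] and [1] of [g] are normalised to sum to one. *)
exists (1 / (1 + mu)); split.
  by apply/andP; split; [apply: divr_ge0|rewrite ler_pdivrMr]; lra.
move=> x Sx.
have -> : (1 - 1 / (1 + mu)) * f x + 1 / (1 + mu) * g x =
          (mu * f x + g x) / (1 + mu) by field; lra.
rewrite ler_pdivlMr; last lra.
have [fx|fx] := ltP (f x) t; first by have := muA _ Sx fx; lra.
have [gx|gx] := leP (g x) t; first by have := muB _ Sx gx; lra.
have : 0 <= mu * (f x - t) by rewrite mulr_ge0// subr_ge0.
lra.
Qed.

(** Where [F m] exceeds [t] nothing is left to do. On the remaining convex sublevel set the
    induction hypothesis gives a mixture [h], which is then combined with [F m] on all of [S]. The
    weak inequality for [f0] is what lets [h] enter [minimax_two]. *)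
Lemma minimax_finite S0 (G : set (V -> R)) (t : R) :
  (forall g, G g -> plain_convex_fun S0 g) ->
  (forall f g (l : R), G f -> G g -> 0 <= l <= 1 ->
     exists2 h, G h & forall x, S0 x -> h x = (1 - l) * f x + l * g x) ->
  forall (F : nat -> V -> R) (f0 : V -> R) (m : nat) S,
  S `<=` S0 -> plain_convex_set S -> G f0 ->
  (forall i, (i < m)%N -> G (F i)) ->
  (forall x, S x -> t <= f0 x \/ exists2 i, (i < m)%N & t < F i x) ->
  exists2 h, G h & forall x, S x -> t <= h x.
Proof.
move=> Gc Gm F f0; elim=> [|m IH] S SS0 Sc Gf0 GF H.
  by exists f0 => // x /H[//|[]].
pose S' := S `&` [set x | F m x <= t].
have GFm : G (F m) by exact: GF.
have S'c : plain_convex_set S'.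
  move=> x y s [Sx Fx] [Sy Fy] s01; split; first exact: Sc.
  apply: le_trans (Gc _ GFm _ _ _ (SS0 _ Sx) (SS0 _ Sy) s01) _.
  rewrite /= in Fx Fy; nra.
have [h Gh ht] : exists2 h, G h & forall x, S' x -> t <= h x.
  apply: IH => //.
  - by move=> x [/SS0].
  - by move=> i im; apply: GF; exact: ltnW.
  - move=> x [Sx /= Fx]; case: (H _ Sx) => [|[i]]; first by left.
    rewrite ltnS leq_eqVlt => /predU1P[->|im] tF; first by lra.
    by right; exists i.
have [|||l [l01 lt]] := @minimax_two S h (F m) t Sc.
- by move=> x y s Sx Sy; apply: Gc => //; exact: SS0.
- by move=> x y s Sx Sy; apply: Gc => //; exact: SS0.
- move=> x Sx; have [Fx|Fx] := leP (F m x) t; last by right.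
  by left; apply: ht.
have [q Gq qE] := Gm _ _ _ Gh GFm l01.
by exists q => // x Sx; rewrite qE; [exact: lt|exact: SS0].
Qed.

End minimax.

(** * Minimax for extended-real convex functions *)

Section minimax_ereal.
Context {R : realType} {V : lmodType R}.
Variables (Y : set V) (E : set (V -> \bar R)).
Hypothesis Yc : plain_convex_set Y.
Hypothesis E_gtNy : forall f, E f -> forall x, Y x -> -oo < f x.
Hypothesis E_convex : forall f, E f -> econvex_fun Y f.
Hypothesis E_mix : forall f g (l : R), E f -> E g -> (0 <= l <= 1)%R ->
  exists2 h, E h & forall x, Y x -> h x = (1 - l)%R%:E * f x + l%:E * g x.
Variables (f0 : V -> \bar R) (w : V) (v c0 : R).
Hypothesis Ef0 : E f0.
Hypothesis Yw : Y w.
Hypothesis E_w : forall f, E f -> f w <= v%:E.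
Hypothesis f0_ge : forall x, Y x -> c0%:E <= f0 x.
Hypothesis E_bounded : forall f, E f ->
  exists c : R, forall x, Y x -> f0 x <= (v + 1)%:E -> c%:E <= f x.

(** Strictly positive weights are essential, since a zero weight would annihilate [+oo]. *)
Lemma mixEy (a b : \bar R) (l : R) : (0 < l < 1)%R -> -oo < a -> -oo < b ->
  (1 - l)%R%:E * a + l%:E * b < +oo -> a < +oo /\ b < +oo.
Proof.
move=> /andP[l0 l1]; have l1' : 0 < (1 - l)%R%:E by rewrite lte_fin subr_gt0.
have l0' : 0 < l%:E by rewrite lte_fin.
move: a b => [a| |] [b| |]// _ _; rewrite ?ltry// ?(gt0_muley l1') ?(gt0_muley l0')//.
Qed.

(** Repeated averaging with weight one half charges every function, so the average is finite only
    where all of them are. *)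
Let dominating (F : nat -> V -> \bar R) m : (forall i, (i < m)%N -> E (F i)) ->
  exists2 h, E h & forall x, Y x -> h x < +oo ->
    f0 x < +oo /\ forall i, (i < m)%N -> F i x < +oo.
Proof.
elim: m => [|m IH] EF; first by exists f0.
have [i im|h Eh hf] := IH _; first by apply: EF; exact: ltnW.
have half01 : (0 < (2^-1 : R) < 1)%R by lra.
have [|q Eq qE] := E_mix (l := 2^-1) Eh (EF m (ltnSn m)); first by lra.
exists q => // x Yx; rewrite qE// => /(mixEy half01)[||hy Fy].
- exact: E_gtNy.
- by apply: E_gtNy => //; exact: EF.
have [f0y Fiy] := hf _ Yx hy; split=> // i.
by rewrite ltnS leq_eqVlt => /predU1P[->//|]; exact: Fiy.
Qed.

(* Off the sublevel set [f0 <= v + 1] this is convexity along the segment to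
   [w], which leaves the sublevel set at distance proportional to
   [1 / (f0 x - v)]. *)
Let linear_lower_bound h : E h ->
  exists2 C : R, (0 < C)%R & forall x, Y x -> f0 x < +oo -> h x < +oo ->
    (- C * Num.max 1 (fine (f0 x) - v) <= fine (h x))%R.
Proof.
move=> Eh; have [c hc] := E_bounded Eh.
exists (`|c| + `|v| + 1)%R; first by rewrite ltr_wpDl// addr_ge0.
move=> x Yx f0y hy.
have f0Ny := E_gtNy Ef0 Yx; have hNy := E_gtNy Eh Yx.
have hcx := hc x Yx.
have /fineK f0E : f0 x \is a fin_num by rewrite fin_numElt f0Ny.
have /fineK hE : h x \is a fin_num by rewrite fin_numElt hNy.
set a := fine (f0 x) in f0E *; set b := fine (h x) in hE *.
have [av|av] := leP (a - v)%R 1%R.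
  have : (c <= b)%R.
    by rewrite -lee_fin hE hcx// -f0E lee_fin; lra.
  have := normr_ge0 c; have := ler_norm (- c)%R; have := normr_ge0 v.
  by rewrite normrN; lra.
(* With this [s], convexity bounds [f0] at the intermediate point by [v + s * (a - v) = v + 1], so
   the lower bound [c] for [h] applies there. *)
pose s := (1 / (a - v))%R.
have s0 : (0 < s)%R by rewrite divr_gt0//; lra.
have s1 : (s <= 1)%R by rewrite ler_pdivrMr; lra.
have s01 : (0 <= s <= 1)%R by rewrite s1 ltW.
have sav : (s * (a - v) = 1)%R by rewrite /s divfK// gt_eqF//; lra.
have s1' : (0 <= 1 - s)%R by rewrite subr_ge0.
have Yz := Yc Yw Yx s01.
have f0z : f0 ((1 - s) *: w + s *: x)%R <= (v + 1)%:E.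
  apply: le_trans (E_convex Ef0 Yw Yx s01) _.
  apply: le_trans (leeD (lee_wpmul2l _ (E_w Ef0)) (lexx _)) _.
    by rewrite lee_fin.
  by rewrite -f0E -!EFinM -EFinD lee_fin; nra.
have := le_trans (hc _ Yz f0z) (E_convex Eh Yw Yx s01).
move=> /le_trans/(_ (leeD (lee_wpmul2l _ (E_w Eh)) (lexx _))).
rewrite lee_fin => /(_ s1').
rewrite -hE -!EFinM -EFinD lee_fin => H.
have cn := ler_norm (- c)%R; have vn := ler_norm v; have vn' := ler_norm (- v)%R.
rewrite !normrN in cn vn'.
rewrite -(ler_pM2l s0).
have -> : (s * (- (`|c| + `|v| + 1) * (a - v)) = - (`|c| + `|v| + 1))%R.
  by rewrite -[RHS]mulr1 -sav; ring.
have : ((1 - s) * v <= `|v|)%R by nra.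
lra.
Qed.


(** Where the auxiliary mixture [p] is finite, so are all the [F i], and the real-valued minimax
    applies. Elsewhere any positive share of [p] makes the value [+oo]. As [p] is bounded below
    where finite, a small share costs at most [e]. *)
Lemma minimax_ereal (F : nat -> V -> \bar R) (m : nat) (t e : R) :
  (0 < e)%R -> (forall i, (i < m)%N -> E (F i)) ->
  (forall x, Y x -> exists2 i, (i < m)%N & t%:E < F i x) ->
  exists2 f, E f & forall x, Y x -> (t - e)%:E <= f x.
Proof.
move=> e0 EF tF.
have [h Eh hF] := dominating EF.
have [C C0 hC] := linear_lower_bound Eh.
(* Chosen so that [1 - th = C * th]: the share of [f0] then cancels the linear decrease allowed to
   [h]. *)
pose th := (1 / (1 + C))%R.
have th01 : (0 < th < 1)%R.
  by apply/andP; split; [apply: divr_gt0|rewrite ltr_pdivrMr]; lra.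
have thE : (1 - th = C * th)%R.
  have : (th * (1 + C) = 1)%R by rewrite /th divfK// gt_eqF//; lra.
  lra.
have [|p Ep pE] := E_mix (l := th) Ef0 Eh; first by lra.
have pfin x : Y x -> p x < +oo -> f0 x < +oo /\ h x < +oo.
  by move=> Yx; rewrite pE// => /(mixEy th01); apply; exact: E_gtNy.
pose K := (`|c0| + 1 + `|v|)%R.
have pK x : Y x -> p x < +oo -> (- K <= fine (p x))%R.
  move=> Yx py; have [f0y hy] := pfin _ Yx py.
  have f0Ny := E_gtNy Ef0 Yx; have hNy := E_gtNy Eh Yx.
  have := hC _ Yx f0y hy.
  have /fineK f0E : f0 x \is a fin_num by rewrite fin_numElt f0Ny.
  have /fineK hE : h x \is a fin_num by rewrite fin_numElt hNy.
  have := f0_ge Yx; rewrite pE// -f0E -hE -!EFinM -EFinD lee_fin/=.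
  set a := fine (f0 x); set b := fine (h x) => ca.

  have thC : (C * th <= 1)%R by lra.
  have cn := ler_norm (- c0)%R; have vn := ler_norm v; have vn' := ler_norm (- v)%R.
  rewrite !normrN in cn vn'; have c0n := normr_ge0 c0; have v0n := normr_ge0 v.
  rewrite thE /K; have [av|av] := leP (a - v)%R 1%R.
    rewrite mulr1 => bC.
    have : (C * th * a + th * b >= C * th * (c0 - 1))%R.
      have : (0 <= C * th * (a - c0))%R by rewrite mulr_ge0//; nra.
      have : (0 <= th * (b + C))%R by rewrite mulr_ge0//; lra.
      lra.
    have : (C * th * (c0 - 1) >= - (`|c0| + 1))%R by nra.
    lra.
    move=> bC; have : (0 <= th * (b - - C * (a - v)))%R by rewrite mulr_ge0//; lra.
  have : (C * th * v >= - `|v|)%R by nra.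
  lra.
pose S := Y `&` [set x | p x < +oo].
have SY : S `<=` Y by move=> x [].
have Efin f x : E f -> Y x -> f x < +oo -> (fine (f x))%:E = f x.
  by move=> Ef Yx fy; rewrite fineK// fin_numElt fy E_gtNy.
have Sc : plain_convex_set S.
  move=> x y s [Yx /= px] [Yy /= py] s01; split; first exact: Yc.
  apply: le_lt_trans (E_convex Ep Yx Yy s01) _.
  by rewrite -(Efin p x)// -(Efin p y)// -!EFinM -EFinD ltry.
pose G := [set g : V -> R | exists2 f, E f & forall x, S x -> f x = (g x)%:E].
have Gc g : G g -> plain_convex_fun S g.
  move=> [f Ef fg] x y s Sx Sy s01.
  have := E_convex Ef (SY _ Sx) (SY _ Sy) s01.
  have Sz := Sc _ _ _ Sx Sy s01.
  by rewrite !fg// -!EFinM -EFinD lee_fin.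
have Gm g1 g2 (l : R) : G g1 -> G g2 -> (0 <= l <= 1)%R ->
    exists2 g, G g & forall x, S x -> g x = ((1 - l) * g1 x + l * g2 x)%R.
  move=> [f1 Ef1 fg1] [f2 Ef2 fg2] l01.
  have [f Ef fE] := E_mix Ef1 Ef2 l01.
  exists (fun x => (1 - l) * g1 x + l * g2 x)%R => //; exists f => // x Sx.
  by rewrite fE ?fg1 ?fg2//; exact: SY.
have Gp : G (fine \o p) by exists p => // x [Yx px]; rewrite /= Efin.
have F_fin x i : S x -> (i < m)%N -> (fine (F i x))%:E = F i x.
  move=> [Yx px] im; rewrite Efin//; first exact: EF.
  by have [_ hx] := pfin _ Yx px; have [_] := hF _ Yx hx; exact.
have GF i : (i < m)%N -> G (fun x => fine (F i x)).
  by move=> im; exists (F i) => [|x Sx]; [exact: EF|rewrite F_fin].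
(* The function [p] serves only as the initial member of the family; the strict bounds come from the
   [F i]. *)
have [|g [f Ef fg] tg] := minimax_finite Gc Gm (fun _ => id) Sc Gp GF (t := t).
  move=> x Sx; right; have [i im tFi] := tF _ (SY _ Sx); exists i => //.
  by rewrite -lte_fin F_fin.
have K1 : (1 <= K)%R.
  by have := normr_ge0 c0; have := normr_ge0 v; rewrite /K; lra.
(* With weight [de = e / D], replacing [t] by [- K] loses at most [de * (|t| + K) <= e]; the summand
   [e] in [D] keeps [de] below one. *)
pose D := (e + `|t| + K)%R.
have tn := normr_ge0 t; have tn' := ler_norm t.
have D0 : (0 < D)%R by rewrite /D; lra.
pose de := (e / D)%R.
have de01 : (0 < de < 1)%R.
  by apply/andP; split; [exact: divr_gt0|rewrite ltr_pdivrMr// /D; lra].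
have deD : (de * D = e)%R by rewrite /de divfK// gt_eqF.
have [|q Eq qE] := E_mix (l := de) Ef Ep; first by lra.
exists q => // x Yx; rewrite qE//.
have [px|] := ltP (p x) +oo.
  have Sx : S x by [].
  have := pK _ Yx px; have := tg _ Sx.
  rewrite fg// -(Efin p x)// -!EFinM -EFinD lee_fin.
  rewrite /D in deD; nra.
rewrite leye_eq => /eqP ->; rewrite gt0_muley ?lte_fin; last by lra.
rewrite addey ?leey// gt_eqF//.
case: (f x) (E_gtNy Ef Yx) => [r| |]//= _; rewrite -?EFinM ?ltNyr//.
by rewrite gt0_muley// lte_fin; lra.
Qed.

End minimax_ereal.

(** * Sums and multiples of extended-real convex functions *)

Section econvex_theory.
Context {R : realType} {V : lmodType R}.
Implicit Types (S : set V) (f g : V -> \bar R).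

Lemma adde_defNy (a b : \bar R) : -oo < a -> -oo < b -> a +? b.
Proof. by move=> ? ?; apply: ltninfty_adde_def; rewrite inE. Qed.

Lemma mule_gtNy (r : R) (a : \bar R) : (0 <= r)%R -> -oo < a -> -oo < r%:E * a.
Proof.
rewrite le_eqVlt => /predU1P[<-|r0]; first by rewrite mul0e ltNyr.
by case: a => [a| |]//= _; rewrite -?EFinM ?ltNyr// gt0_muley ?lte_fin.
Qed.

Lemma adde_gtNy (a b : \bar R) : -oo < a -> -oo < b -> -oo < a + b.
Proof. by move: a b => [a| |] [b| |]//= _ _; rewrite -EFinD ltNyr. Qed.

Lemma econvex_funD S f g :
  (forall x, S x -> -oo < f x) -> (forall x, S x -> -oo < g x) ->
  econvex_fun S f -> econvex_fun S g -> econvex_fun S (fun x => f x + g x).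
Proof.
move=> fNy gNy fc gc x y s Sx Sy s01.
apply: le_trans (leeD (fc _ _ _ Sx Sy s01) (gc _ _ _ Sx Sy s01)) _.
have def z : S z -> f z +? g z by move=> Sz; rewrite adde_defNy ?fNy ?gNy.
by rewrite addeACA !muleDr//; exact: def.
Qed.

Lemma econvex_funZ S f (r : R) : (0 <= r)%R ->
  (forall x, S x -> -oo < f x) ->
  econvex_fun S f -> econvex_fun S (fun x => r%:E * f x).
Proof.
move=> r0 fNy fc x y s Sx Sy /[dup] s01 /andP[s0 s1].
apply: le_trans (lee_wpmul2l _ (fc _ _ _ Sx Sy s01)) _; first by rewrite lee_fin.
rewrite muleDr//; first by rewrite (muleCA r%:E) [X in _ + X <= _](muleCA r%:E).
by apply: adde_defNy; apply: mule_gtNy; rewrite ?subr_ge0 ?fNy.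
Qed.

(** Both conclusions are proved together: convexity of a longer sum uses that the shorter one stays
    above [-oo]. *)
Lemma econvex_fun_sum S (I : Type) (r : seq I) (F : I -> V -> \bar R) :
  (forall i x, S x -> -oo < F i x) -> (forall i, econvex_fun S (F i)) ->
  (forall x, S x -> -oo < \sum_(i <- r) F i x) /\
  econvex_fun S (fun x => \sum_(i <- r) F i x).
Proof.
move=> FNy Fc; elim: r => [|i r [IH1 IH2]].
  split=> [x _|x y s _ _ _]; first by rewrite big_nil ltNyr.
  by rewrite !big_nil !mule0 adde0.
split=> [x Sx|x y s Sx Sy s01].
  by rewrite big_cons; apply: adde_gtNy; [exact: FNy|exact: IH1].
by rewrite !big_cons; apply: (econvex_funD (FNy i) IH1 (Fc i) IH2).
Qed.

End econvex_theory.

(** * Closed convex functions and their sublevel sets *)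

Section closed_convex_theory.
Context {R : realType} {n : nat}.
Implicit Types (X Y : set 'rV[R]_n) (f : 'rV[R]_n -> \bar R).

Lemma convex_set_plain X : convex_set X -> plain_convex_set X.
Proof.
move=> Xc x y s Xx Xy /andP[s0 s1].
(* The combination in [convex_set] puts the weight [s] on its first point, hence the exchanged
   points. *)
have := Xc y x (Itv01 s0 s1); rewrite !inE => /(_ Xy Xx).
by rewrite /conv/= addrC.
Qed.

(** Finite values are combined inside the epigraph. The endpoints of [s] are split off because a
    zero weight hides [+oo]; otherwise an infinite value makes the right-hand side [+oo]. *)
Lemma closed_convex_econvex X f : closed_convex X f -> econvex_fun X f.
Proof.
move=> [fNy _ fc] x y s Xx Xy /andP[s0 s1].
have [->|s_neq0] := eqVneq s 0%R.
  by rewrite subr0 scale1r scale0r addr0 mul1e mul0e adde0.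
have [->|s_neq1] := eqVneq s 1%R.
  by rewrite subrr scale1r scale0r add0r mul1e mul0e add0e.
have s0' : (0 < s)%R by rewrite lt_def s_neq0.
have s1' : (0 < 1 - s)%R by rewrite subr_gt0 lt_neqAle s_neq1.
move: (fNy _ Xx) (fNy _ Xy).
case Ex : (f x) => [a| |]//; case Ey : (f y) => [b| |]//= _ _; last 3 first.
- by rewrite [X in _ + X]gt0_muley ?lte_fin// addey ?leey// -EFinM.
- by rewrite [X in X + _]gt0_muley ?lte_fin// addye ?leey// -EFinM.
- by rewrite !gt0_muley ?lte_fin// leey.
have := fc (y, b) (x, a) (Itv01 s0 s1); rewrite !inE => H.
have [//|//|_ /=] := H _ _.
- by split=> //=; rewrite Ey.
- by split=> //=; rewrite Ex.
by rewrite -!EFinM -EFinD addrC [X in X%:E]addrC.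
Qed.

Lemma closed_sublevel X f (c : R) : closed_convex X f ->
  closed [set x | X x /\ f x <= c%:E].
Proof.
move=> [_ fcl _].
apply: (@preimage_closed _ ('rV[R]_n * R^o)%type (fun x => (x, c))
  (epigraph X f)) => // x _.
exact: (@cvg_pair _ _ _ _ (nbhs x) (nbhs (c : R^o)) _ _ _
  (fun x => x) (fun=> c) cvg_id (cvg_cst _)).
Qed.

Lemma convex_sublevel X f (c : R) : convex_set X -> closed_convex X f ->
  plain_convex_set [set x | X x /\ f x <= c%:E].
Proof.
move=> /convex_set_plain Xc /closed_convex_econvex fc x y s [Xx fx] [Xy fy] s01.
split; first exact: Xc.
apply: le_trans (fc _ _ _ Xx Xy s01) _; case/andP: s01 => s0 s1.
apply: (@le_trans _ _ ((1 - s)%:E * c%:E + s%:E * c%:E)).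
  by apply: leeD; apply: lee_wpmul2l; rewrite ?lee_fin ?subr_ge0.
by rewrite -!EFinM -EFinD -mulrDl subrK mul1r.
Qed.

(** Otherwise the closed sets [f <= - j] all meet the compact ball, and by the finite intersection
    property a common point would have value [-oo]. *)
Lemma closed_convex_bounded_below X f (M : R) : closed_convex X f ->
  exists c : R, forall x, X x -> (`|x| <= M)%R -> c%:E <= f x.
Proof.
move=> fcc; apply: contrapT => nex.
have {}nex (c : R) : exists x, [/\ X x, (`|x| <= M)%R & f x <= c%:E].
  apply: contrapT => nx; apply: nex; exists c => x Xx xM; rewrite leNgt.
  by apply/negP => /ltW fx; apply: nx; exists x.
pose B := [set x : 'rV[R]_n | (`|x| <= M)%R].
have Bcl : closed B.
  apply: (@preimage_closed _ _ (fun x : 'rV[R]_n => `|x|%R) [set r | (r <= M)%R]).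
    by move=> x _; exact: norm_continuous.
  exact: closed_le.
have Bco : compact B.
  apply: bounded_closed_compact => //; exists M; split=> [|r Mr x /= xM].
    exact: num_real.
  exact: le_trans xM (ltW Mr).
pose F (j : nat) := B `&` [set x | X x /\ f x <= (- j%:R)%:E].
move: Bco; rewrite compact_In0 => /(_ nat setT F) [||x Fx].
- exists (fun j => [set x | X x /\ f x <= (- j%:R)%:E]) => // j _.
  exact: closed_sublevel.
- move=> D _; have [x [Xx xM fx]] := nex (- (\max_(j <- finmap.enum_fset D) j)%N%:R)%R.
  exists x => j /= jD; split=> //; split=> //; apply: le_trans fx _.
  rewrite lee_fin lerN2 ler_nat; exact: (@leq_bigmax_seq _ _ xpredT (fun j : nat => j)).
have [fNy _ _] := fcc; have [_ [Xx _]] := Fx 0%N Logic.I.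
move: (fNy _ Xx); case E : (f x) => [r| |]// _.
  have [_ [_]] := Fx (Num.bound `|r|) Logic.I; rewrite E lee_fin lerNr.
  have rn := ler_norm (- r)%R; rewrite normrN in rn.
  by rewrite leNgt (le_lt_trans rn)// archi_boundP.
by have [_ [_]] := Fx 0%N Logic.I; rewrite E.
Qed.

End closed_convex_theory.

(** * Near-optimal distributions for the robust problem *)

Section robust_minimax.
Context {R : realType} {n k N : nat}.
Let T := borelRV R k.
Variables (X Y : set 'rV[R]_n) (Xi : set 'rV[R]_k).
Variable ell : 'rV[R]_n -> 'rV[R]_k -> \bar R.
Variable xi : 'I_N.+1 -> T.
Hypothesis Y_closed : closed Y.
Hypothesis Y_convex : plain_convex_set Y.
Hypothesis YX : Y `<=` X.
Hypothesis Xi_closed : closed Xi.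
Hypothesis Xi_xi : forall i, Xi (xi i).
Hypothesis ell_cc : forall z, Xi z -> closed_convex X (ell ^~ z).
Hypothesis ell_usc : forall x, X x ->
  @upper_semicontinuous (subspace Xi) R (ell x).

Let saa x := expect Xi (empirical xi : probability T R) (ell x).

Lemma measurable_loss x : X x -> measurable_fun (Xi : set T) (ell x).
Proof. by move=> Xx; apply: usc_measurable_borelRV; exact: ell_usc. Qed.

Let mXi : measurable (Xi : set T).
Proof. exact: closed_measurable_borelRV. Qed.

Lemma loss_gtNy x z : X x -> Xi z -> -oo < ell x z.
Proof. by move=> Xx Xz; have [+ _ _] := ell_cc Xz; exact. Qed.

Lemma expect_mixture x (l : {i01 R}) (P Q : probability T R) : X x ->
  expect Xi (mixture l P Q) (ell x) =
  (1 - l%:num)%R%:E * expect Xi P (ell x) + l%:num%:E * expect Xi Q (ell x).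
Proof. by move=> Xx; apply: integral_mixture => //; exact: measurable_loss. Qed.

Lemma probabilities_on_empirical : probabilities_on Xi (empirical xi).
Proof.
rewrite /probabilities_on /= /empirical.
rewrite (eq_bigr (fun=> 1)) => [|i _]; last by rewrite diracE mem_set.
by rewrite sumEFin sumr_const card_ord -EFinM mulVf// pnatr_eq0.
Qed.

Lemma expect_empirical x : X x ->
  saa x = (N.+1%:R^-1)%R%:E * \sum_(i < N.+1) ell x (xi i).
Proof.
move=> Xx; apply: integral_empirical => //; first exact: measurable_loss.
by move=> i; exact: loss_gtNy.
Qed.

Lemma expect_dirac x z : X x -> Xi z ->
  expect Xi (\d_(z : T) : probability T R) (ell x) = ell x z.
Proof.
move=> Xx Xz; rewrite /expect integral_dirac//; last exact: measurable_loss.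
by rewrite diracE mem_set ?mul1e.
Qed.

Lemma expect_le_worst_case x (Q : probability T R) : probabilities_on Xi Q ->
  expect Xi Q (ell x) <= worst_case Xi ell x.
Proof.
move=> QXi; apply: integral_le_cst => // z Xz.
by apply: ereal_sup_ubound; exists z.
Qed.

Lemma expect_empirical_gtNy_convex :
  (forall x, X x -> -oo < saa x) /\
  (convex_set X -> econvex_fun X saa).
Proof.
have N0 : (0 <= (N.+1%:R^-1 : R))%R by rewrite invr_ge0.
have [||sNy sc] := @econvex_fun_sum R _ X _ (index_enum 'I_N.+1)
  (fun i x => ell x (xi i)).
- by move=> i x Xx; exact: loss_gtNy.
- by move=> i; apply: closed_convex_econvex; exact: ell_cc.
split=> [x Xx|Xc x y s Xx Xy s01].
  by rewrite expect_empirical//; apply: mule_gtNy => //; exact: sNy.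
have Xz := convex_set_plain Xc Xx Xy s01.
rewrite !expect_empirical//.
exact: (econvex_funZ N0 sNy sc Xx Xy s01).
Qed.

Variables (w : 'rV[R]_n) (v c0 : R).
Hypothesis X_convex : convex_set X.
Hypothesis saa_coercive : coercive X saa.
Hypothesis saa_ge : forall x, Y x -> c0%:E <= saa x.
Hypothesis Yw : Y w.
Hypothesis ro_w : worst_case Xi ell w <= v%:E.
Hypothesis ro_ge : forall x, Y x -> v%:E <= worst_case Xi ell x.

(* On the set where all sampled losses are at most [t] coercivity provides
   compactness, which leaves finitely many scenarios to consider. *)
Let finite_scenarios (t : R) : (t < v)%R ->
  exists s : seq 'rV[R]_k, (forall z, z \in s -> Xi z) /\
    forall x, Y x -> exists2 z, z \in s & t%:E < ell x z.
Proof.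
move=> tv.
(* If all sampled losses are at most [t], so is their average; hence [C] lies in a sublevel set that
   coercivity bounds. *)
pose C := Y `&` [set x | forall i, X x /\ ell x (xi i) <= t%:E].
have Ccl : closed C.
  apply: closedI => //.
  rewrite (_ : [set x | _] =
      \bigcap_(i in [set: 'I_N.+1]) [set x | X x /\ ell x (xi i) <= t%:E]).
    by apply: closed_bigI => i _; apply: closed_sublevel; exact: ell_cc.
  by apply/seteqP; split=> x /= H i; [move=> _; exact: H|exact: H].
have Cco : compact C.
  apply: bounded_closed_compact => //.
  have [M [Mreal HM]] := saa_coercive t; exists M; split=> // r Mr x [Yx Cx].
  apply: (HM r Mr); split; first exact: YX.
  rewrite expect_empirical; last exact: YX.
  rewrite lee_pdivrMl//.
  apply: (@le_trans _ _ (\sum_(i < N.+1) t%:E)).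
    by apply: lee_sum => i _; have [] := Cx i.
  by rewrite sumEFin sumr_const card_ord -EFinM mulr_natl.
pose F (z : 'rV[R]_k) := C `&` [set x | X x /\ ell x z <= t%:E].
apply: contrapT => no_s.
move: Cco; rewrite compact_In0 => /(_ _ Xi F) [||x Fx].
- exists (fun z => [set x | X x /\ ell x z <= t%:E]) => // z Xz.
  by apply: closed_sublevel; exact: ell_cc.
- move=> D DXi; apply: contrapT => D0; apply: no_s.
  (* A point where this list fails has all sampled losses at most [t], hence lies in [C], and thus
     in every [F z] with [z] in [D]. *)
  pose s := [seq xi i | i <- index_enum 'I_N.+1] ++ finmap.enum_fset D.
  exists s; split=> [z|x Yx].
    rewrite mem_cat => /orP[/mapP[i _ ->]//|zD].
    exact: set_mem (DXi z zD).
  apply: contrapT => nz.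
  have {}nz z : z \in s -> ell x z <= t%:E.
    by move=> zs; rewrite leNgt; apply/negP => tz; apply: nz; exists z.
  apply: D0; exists x => z /= zD; split; last first.
    by split; [exact: YX|apply: nz; rewrite mem_cat zD orbT].
  split=> // i; split; first exact: YX.
  by apply: nz; rewrite mem_cat map_f// mem_index_enum.
- have [[Yx _] _] := Fx _ (Xi_xi ord0).
  have := ro_ge Yx; rewrite leNgt => /negP; apply.
  apply: le_lt_trans (_ : _ <= t%:E) _; last by rewrite lte_fin.
  by apply: ge_ereal_sup => _ [z Xz <-]; have [_ []] := Fx z Xz.
Qed.

(** The expected losses to which [minimax_ereal] applies. The last three properties are carried
    along because they are not guaranteed for an arbitrary [Q]. *)
Let E : set ('rV[R]_n -> \bar R) := [set f | [/\
  exists2 Q, probabilities_on Xi Q & f = (fun x => expect Xi Q (ell x)),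
  forall x, Y x -> -oo < f x, econvex_fun Y f &
  exists c : R, forall x, Y x -> saa x <= (v + 1)%:E -> c%:E <= f x]].

Let E_dirac z : Xi z ->
  E (fun x => expect Xi (\d_(z : T) : probability T R) (ell x)).
Proof.
move=> Xz; split.
- exists (\d_(z : T) : probability T R) => //.
  by rewrite /probabilities_on /= diracE mem_set.
- by move=> x /YX Xx; rewrite expect_dirac//; exact: loss_gtNy.
- move=> x y s /[dup] Yx /YX Xx /[dup] Yy /YX Xy s01.
  rewrite !expect_dirac//; last exact/YX/Y_convex.
  exact: (closed_convex_econvex (ell_cc Xz)).
(* Coercivity bounds the sublevel set of the sampled loss, and a closed convex function is bounded
   below on bounded sets. *)
- have [M [_ HM]] := saa_coercive (v + 1)%R.
  have [c Hc] := closed_convex_bounded_below (M + 1)%R (ell_cc Xz).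
  exists c => x /YX Xx saax; rewrite expect_dirac//; apply: Hc => //.
  by apply: (HM (M + 1)%R); rewrite ?ltrDl.
Qed.

Let E_saa : E saa.
Proof.
have [saaNy saac] := expect_empirical_gtNy_convex.
split.
- by exists (empirical xi) => //; exact: probabilities_on_empirical.
- by move=> x /YX; exact: saaNy.
- by move=> x y s /YX Xx /YX Xy; exact: saac.
- by exists c0 => x Yx _; exact: saa_ge.
Qed.

Let E_mix f g (l : R) : E f -> E g -> (0 <= l <= 1)%R ->
  exists2 h, E h & forall x, Y x -> h x = (1 - l)%R%:E * f x + l%:E * g x.
Proof.
move=> [[P PXi fE] fNy fc [cf Hf]] [[Q QXi gE] gNy gc [cg Hg]] /andP[l0 l1].
pose h x := expect Xi (mixture (Itv01 l0 l1) P Q) (ell x).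
have hE x : Y x -> h x = (1 - l)%R%:E * f x + l%:E * g x.
  by move=> /YX Xx; rewrite /h expect_mixture// fE gE.
have l1' : (0 <= 1 - l)%R by rewrite subr_ge0.
have lfNy x : Y x -> -oo < (1 - l)%R%:E * f x.
  by move=> Yx; apply: mule_gtNy => //; exact: fNy.
have lgNy x : Y x -> -oo < l%:E * g x.
  by move=> Yx; apply: mule_gtNy => //; exact: gNy.
exists h => //; split.
- exists (mixture (Itv01 l0 l1) P Q) => //.
  rewrite /probabilities_on /= /mixture.
  by rewrite PXi QXi !mule1 -EFinD subrK.
- by move=> x Yx; rewrite hE//; apply: adde_gtNy; [exact: lfNy|exact: lgNy].
- move=> x y s Yx Yy s01; rewrite !hE//; last exact: Y_convex.
  exact: (econvex_funD lfNy lgNy (econvex_funZ l1' fNy fc)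
    (econvex_funZ l0 gNy gc)).
- exists ((1 - l) * cf + l * cg)%R => x Yx saax; rewrite hE// EFinD !EFinM.
  by apply: leeD; apply: lee_wpmul2l; rewrite ?lee_fin//; [exact: Hf|exact: Hg].
Qed.

(** Half of [e] brings the level strictly below [v], which makes finitely many scenarios enough; the
    other half is lost in the minimax. *)
Lemma robust_minimax (e : R) : (0 < e)%R ->
  exists2 Q, probabilities_on Xi Q &
    forall x, Y x -> (v - e)%:E <= expect Xi Q (ell x).
Proof.
move=> e0; have e2 : (0 < e / 2)%R by rewrite divr_gt0.
have [|s [sXi Hs]] := @finite_scenarios (v - e / 2)%R.
  by rewrite ltrBlDr ltrDl.
pose F i x := expect Xi (\d_(nth 0%R s i : T) : probability T R) (ell x).
have E_gtNy f : E f -> forall x, Y x -> -oo < f x by case.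
have E_convex f : E f -> econvex_fun Y f by case.
have E_w f : E f -> f w <= v%:E.
  by move=> [[Q QXi ->] _ _ _]; exact: le_trans (expect_le_worst_case _ QXi) _.
have E_bd f : E f ->
    exists c : R, forall x, Y x -> saa x <= (v + 1)%:E -> c%:E <= f x by case.
have EF i : (i < size s)%N -> E (F i).
  by move=> si; apply: E_dirac; apply: sXi; exact: mem_nth.
have tF x : Y x -> exists2 i, (i < size s)%N & (v - e / 2)%:E < F i x.
  move=> Yx; have [z zs tz] := Hs _ Yx; exists (index z s).
    by rewrite index_mem.
  by rewrite /F nth_index// expect_dirac//; [exact: YX|exact: sXi].
have [f Ef fge] := minimax_ereal Y_convex E_gtNy E_convex E_mix E_saa Yw E_w
  saa_ge E_bd e2 EF tF.
have [[Q QXi fE] _ _ _] := Ef; exists Q => // x Yx.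
by have := fge _ Yx; rewrite fE (_ : v - e / 2 - e / 2 = v - e)%R//; lra.
Qed.

End robust_minimax.

(** * Concavity and endpoint tightness *)

Section concavity.
Context {R : realType}.

(** For finite [y] the bound passes to the supremum by solving for [a]. For [y = +oo] the element
    above [-oo] forces [c = +oo], and for [y = -oo] the sum is [-oo]. *)
Lemma mule_sup_add_le (S : set (\bar R)) (r : R) (y c : \bar R) :
  (0 < r)%R -> (exists2 a, S a & -oo < a) ->
  (forall a, S a -> r%:E * a + y <= c) -> r%:E * ereal_sup S + y <= c.
Proof.
move=> r0 [a0 Sa0 a0Ny] H; move: y H => [y| |] H; last by rewrite addeNy leNye.
  rewrite -leeBrDr// -lee_pdivlMl//; apply: ge_ereal_sup => a Sa.
  by rewrite lee_pdivlMl// leeBrDr//; exact: H.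
apply: le_trans (H _ Sa0); rewrite [leRHS]addey ?leey// gt_eqF//.
by apply: mule_gtNy => //; exact: ltW.
Qed.

(** The two suprema are taken one after the other. Zero weights are treated apart, since they
    annihilate a supremum. *)
Lemma concave_radius_sup (A : R -> set (\bar R)) :
  (forall r, (0 <= r)%R -> exists2 a, A r a & -oo < a) ->
  (forall r s (t : R) a b, (0 <= r)%R -> (0 <= s)%R -> (0 <= t <= 1)%R ->
    A r a -> A s b -> exists2 c, A ((1 - t) * r + t * s)%R c &
      (1 - t)%R%:E * a + t%:E * b <= c) ->
  concave_radius (fun r => ereal_sup (A r)).
Proof.
move=> A0 AA r s t r0 s0 /[dup] t01 /andP[t0 t1].
have [a0 Aa0 a0Ny] := A0 _ r0; have [b0 Ab0 b0Ny] := A0 _ s0.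
have le_sup a b : A r a -> A s b -> (1 - t)%R%:E * a + t%:E * b <=
    ereal_sup (A ((1 - t) * r + t * s)%R).
  move=> Aa Ab; have [c Ac abc] := AA _ _ _ _ _ r0 s0 t01 Aa Ab.
  by apply: le_trans abc _; exact: ereal_sup_ubound.
have [t_eq0|t_neq0] := eqVneq t 0%R.
  rewrite t_eq0 subr0 mul1e !mul0e adde0 mul1r mul0r addr0.
  apply: ge_ereal_sup => a Aa; have := le_sup _ _ Aa Ab0.
  by rewrite t_eq0 subr0 mul1e !mul0e adde0 mul1r mul0r addr0.
have [t_eq1|t_neq1] := eqVneq t 1%R.
  rewrite t_eq1 subrr mul1e !mul0e add0e mul1r mul0r add0r.
  apply: ge_ereal_sup => b Ab; have := le_sup _ _ Aa0 Ab.
  by rewrite t_eq1 subrr mul1e !mul0e add0e mul1r mul0r add0r.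
have t0' : (0 < t)%R by rewrite lt_def t_neq0.
have t1' : (0 < 1 - t)%R by rewrite subr_gt0 lt_neqAle t_neq1.
apply: mule_sup_add_le => //; first by exists a0.
move=> a Aa; rewrite addeC; apply: mule_sup_add_le => //; first by exists b0.
by move=> b Ab; rewrite addeC; exact: le_sup.
Qed.

Lemma concave_radius_inf (I : Type) (D : set I) (J : I -> R -> \bar R) :
  (forall i, D i -> concave_radius (J i)) ->
  concave_radius (fun r => ereal_inf [set J i r | i in D]).
Proof.
move=> Jc r s t r0 s0 /[dup] t01 /andP[t0 t1].
apply: le_ereal_inf_tmp => _ [i Di <-]; apply: le_trans (Jc _ Di _ _ _ r0 s0 t01).
by apply: leeD; apply: lee_wpmul2l; rewrite ?lee_fin ?subr_ge0//;
  apply: ereal_inf_lbound; exists i.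
Qed.

End concavity.

(** * The three values as functions of the radius *)

Section value_functions.
Context {R : realType} {n k : nat}.
Let T := borelRV R k.
Variables (X : set 'rV[R]_n) (Xi : set 'rV[R]_k).
Variable ell : 'rV[R]_n -> 'rV[R]_k -> \bar R.
Variable d : 'rV[R]_k -> 'rV[R]_k -> R.
Hypothesis Xi_closed : closed Xi.
Hypothesis ell_usc : forall x, X x ->
  @upper_semicontinuous (subspace Xi) R (ell x).
Hypothesis d_metric : is_metric Xi d.
Variable P : probability T R.
Hypothesis PXi : probabilities_on Xi P.
Implicit Types (Y : set 'rV[R]_n) (Q : probability T R).

Lemma le_wasserstein_ball (r s : R) : (r <= s)%R ->
  wasserstein_ball Xi d P r `<=` wasserstein_ball Xi d P s.
Proof.
by move=> rs Q [QXi W]; split=> //; apply: le_trans W _; rewrite lee_fin.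
Qed.

Lemma wasserstein_ball_center (r : R) : (0 <= r)%R ->
  wasserstein_ball Xi d P r P.
Proof.
move=> r0; split=> //; apply: le_trans (wasserstein_refl d_metric P) _.
by rewrite lee_fin.
Qed.

Lemma wasserstein_ball_mixture (r s : R) (l : {i01 R}) Q1 Q2 :
  wasserstein_ball Xi d P r Q1 -> wasserstein_ball Xi d P s Q2 ->
  wasserstein_ball Xi d P ((1 - l%:num) * r + l%:num * s)%R (mixture l Q1 Q2).
Proof.
move=> [Q1Xi W1] [Q2Xi W2]; split; last exact: wasserstein_mixture.
rewrite /probabilities_on /= /mixture Q1Xi Q2Xi !mule1 -EFinD.
by rewrite subrK.
Qed.

Lemma eq_expect Q Q' (f : 'rV[R]_k -> \bar R) :
  (forall A, measurable A -> Q A = Q' A) -> expect Xi Q f = expect Xi Q' f.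
Proof. by move=> QQ'; apply: eq_measure_integral => A mA _; exact: QQ'. Qed.

Lemma eq_dual_objective Y Q Q' :
  (forall A, measurable A -> Q A = Q' A) ->
  dual_objective Xi ell Y Q = dual_objective Xi ell Y Q'.
Proof.
move=> QQ'; congr (ereal_inf (image _ _)); apply/funext => x.
exact: eq_expect.
Qed.

Lemma wasserstein_ball_ext (r : R) Q Q' :
  (forall A, measurable A -> Q A = Q' A) ->
  wasserstein_ball Xi d P r Q -> wasserstein_ball Xi d P r Q'.
Proof.
move=> QQ' [QXi W]; split; last by rewrite -(wasserstein_eql _ _ _ QQ').
by rewrite /probabilities_on /= -QQ'//; exact: closed_measurable_borelRV.
Qed.

(** The dual path consists of literal mixtures; this admits any distribution that agrees with one on
    measurable sets. *)
Lemma mixture_in_lower_bound (r : R) Y Q0 (l : {i01 R}) Q :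
  (forall A, measurable A -> Q A = mixture l P Q0 A) ->
  wasserstein_ball Xi d P r Q ->
  [set dual_objective Xi ell Y B
    | B in dual_path P Q0 `&` wasserstein_ball Xi d P r]
  (dual_objective Xi ell Y Q).
Proof.
move=> E QB; exists (mixture l P Q0); last first.
  by apply: eq_dual_objective => A mA; rewrite E.
by split; [exists l|exact: wasserstein_ball_ext E QB].
Qed.

Lemma mixture0 Q0 A : mixture (Itv01 (lexx 0%R) ler01) P Q0 A = P A.
Proof. by rewrite /mixture/= subr0 mul1e mul0e adde0. Qed.

Lemma mixture1 Q0 A : mixture (Itv01 ler01 (lexx 1%R)) P Q0 A = Q0 A.
Proof. by rewrite /mixture/= subrr mul1e mul0e add0e. Qed.

Lemma primal_value_nondecreasing Y :
  nondecreasing_radius (primal_value Xi ell d Y P).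
Proof.
move=> r s _ rs; apply: le_ereal_inf_tmp => _ [x Yx <-].
apply: (@le_trans _ _ (ereal_sup [set expect Xi Q (ell x)
    | Q in wasserstein_ball Xi d P r])).
  by apply: ereal_inf_lbound; exists x.
apply: ereal_sup_le => _ [Q QB <-]; exists Q => //.
exact: le_wasserstein_ball QB.
Qed.

Lemma lower_bound_nondecreasing Y Q0 :
  nondecreasing_radius (lower_bound Xi ell d Y P Q0).
Proof.
move=> r s _ rs; apply: ereal_sup_le => _ [Q [QP QB] <-]; exists Q => //.
by split=> //; exact: le_wasserstein_ball QB.
Qed.

Lemma primal_value_concave Y : Y `<=` X ->
  (forall x, Y x -> -oo < expect Xi P (ell x)) ->
  concave_radius (primal_value Xi ell d Y P).
Proof.
move=> YX PNy; apply: concave_radius_inf => x Yx.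
apply: concave_radius_sup => [r r0|r s t a b r0 s0 /andP[t0 t1]].
  exists (expect Xi P (ell x)); last exact: PNy.
  by exists P => //; exact: wasserstein_ball_center.
move=> [Q1 Q1B <-] [Q2 Q2B <-]; pose l := Itv01 t0 t1.
exists (expect Xi (mixture l Q1 Q2) (ell x)).
  by exists (mixture l Q1 Q2) => //; exact: (wasserstein_ball_mixture l).
by rewrite (expect_mixture Xi_closed ell_usc)//; exact: YX.
Qed.

Lemma lower_bound_concave Y Q0 : Y `<=` X ->
  -oo < dual_objective Xi ell Y P ->
  concave_radius (lower_bound Xi ell d Y P Q0).
Proof.
move=> YX PNy; apply: concave_radius_sup.
  move=> r r0; exists (dual_objective Xi ell Y P) => //.
  apply: (@mixture_in_lower_bound r Y Q0 (Itv01 (lexx 0%R) ler01) P).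
    by move=> A _; rewrite mixture0.
  exact: wasserstein_ball_center.
move=> r s t a b r0 s0 /andP[t0 t1].
move=> [C1 [[l1 _ <-] B1B] <-] [C2 [[l2 _ <-] B2B] <-].
pose l := Itv01 t0 t1; pose B1 : probability T R := mixture l1 P Q0.
pose B2 : probability T R := mixture l2 P Q0.
(* A mixture of two points of the dual path is again on it, with the averaged parameter. *)
have l01 : (0 <= (1 - t) * l1%:num + t * l2%:num <= 1)%R.
  have l1ge : (0 <= l1%:num)%R by [].
  have l2ge : (0 <= l2%:num)%R by [].
  have l1le : (l1%:num <= 1)%R by [].
  have l2le : (l2%:num <= 1)%R by [].
  by apply/andP; split; nra.
pose l' := Itv01 (andP l01).1 (andP l01).2.
have E A : measurable A -> mixture l B1 B2 A = mixture l' P Q0 A.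
  move=> mA; rewrite /B1 /B2 /mixture/= /mixture.
  have := fin_num_measure P A mA; have := fin_num_measure Q0 A mA.
  move=> /fineK <- /fineK <-; rewrite -!(EFinM, EFinD).
  by congr EFin; ring.
exists (dual_objective Xi ell Y (mixture l B1 B2)).
  apply: (@mixture_in_lower_bound _ Y Q0 l' (mixture l B1 B2) E).
  exact: (wasserstein_ball_mixture l B1B B2B).
apply: le_ereal_inf_tmp => _ [x Yx <-].
rewrite (expect_mixture Xi_closed ell_usc)//; last exact: YX.
by apply: leeD; apply: lee_wpmul2l; rewrite ?lee_fin ?subr_ge0//;
  apply: ereal_inf_lbound; exists x.
Qed.

End value_functions.

(** * Closedness and convexity of the feasible set *)

Section feasible_set.
Context {R : realType} {n k M : nat}.
Variables (X : set 'rV[R]_n) (Xi : set 'rV[R]_k).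
Variables (g : 'I_M -> 'rV[R]_n -> 'rV[R]_k -> \bar R) (gamma : 'I_M -> R).
Hypothesis g_cc : forall m xi, Xi xi -> closed_convex X (fun x => g m x xi).

Lemma closed_feasible : closed X -> closed (feasible Xi X g gamma).
Proof.
move=> Xcl; rewrite (_ : feasible Xi X g gamma =
    X `&` \bigcap_(xi in Xi) \bigcap_(m in [set: 'I_M])
      [set x | X x /\ g m x xi <= (gamma m)%:E]).
  apply: closedI => //; apply: closed_bigI => xi Xxi; apply: closed_bigI => m _.
  exact/closed_sublevel/g_cc.
apply/seteqP; split=> x [Xx gx]; split=> //.
  by move=> xi Xxi m _; split=> //; exact: gx.
by move=> xi Xxi m; have [] := gx xi Xxi m Logic.I.
Qed.

Lemma convex_feasible : convex_set X -> plain_convex_set (feasible Xi X g gamma).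
Proof.
move=> Xc x y s [Xx gx] [Xy gy] s01; split; first exact: (convex_set_plain Xc).
move=> xi Xxi m; have [] := convex_sublevel Xc (g_cc m Xxi)
  (conj Xx (gx xi Xxi m)) (conj Xy (gy xi Xxi m)) s01.
by [].
Qed.

End feasible_set.

Theorem theorem5 (R : realType) (n k M N : nat)
  (X : set 'rV[R]_n) (Xi : set 'rV[R]_k)
  (ell : 'rV[R]_n -> 'rV[R]_k -> \bar R)
  (g : 'I_M -> 'rV[R]_n -> 'rV[R]_k -> \bar R) (gamma : 'I_M -> R)
  (d : 'rV[R]_k -> 'rV[R]_k -> R)
  (xihat : 'I_N.+1 -> borelRV R k)
  (x0 xinf : 'rV[R]_n) (Qinf : probability (borelRV R k) R) :
  let XXi := feasible Xi X g gamma in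
  let Phat : probability (borelRV R k) R := empirical xihat in
  let saa := fun x => expect Xi Phat (ell x) in
  let ro := worst_case Xi ell in
  closed X -> convex_set X ->
  Xi !=set0 -> closed Xi -> convex_set Xi ->
  (forall xi, Xi xi -> closed_convex X (ell ^~ xi)) ->
  (forall x, X x -> @upper_semicontinuous (subspace Xi) R (ell x)) ->
  (forall m xi, Xi xi -> closed_convex X (fun x => g m x xi)) ->
  XXi !=set0 ->
  (forall i, Xi (xihat i)) ->
  is_metric Xi d ->
  lower_semicontinuous
    (fun z : subspace (Xi `*` Xi) => (d z.1 z.2)%:E : \bar R) ->
  optimal_solution XXi saa x0 -> saa x0 \is a fin_num ->
  optimal_solution XXi ro xinf -> ro xinf \is a fin_num ->
  coercive X saa ->
  (exists U K, [/\ nbhs xinf U, compact K, K `<=` Xi &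
     forall x, (U `&` X) x -> is_max [set ell x xi | xi in K] (ro x)]) ->
  probabilities_on Xi Qinf ->
  (forall Q, probabilities_on Xi Q ->
     dual_objective Xi ell XXi Q <= dual_objective Xi ell XXi Qinf) ->
  let Jstar := primal_value Xi ell d XXi Phat in
  let Jupper := primal_value Xi ell d (segment x0 xinf) Phat in
  let Jlower := lower_bound Xi ell d XXi Phat Qinf in
  [/\ [/\ nondecreasing_radius Jstar, nondecreasing_radius Jupper &
          nondecreasing_radius Jlower],
      [/\ concave_radius Jstar, concave_radius Jupper &
          concave_radius Jlower] &
      forall rho : R,
        rho = 0%R \/ wasserstein Xi d Phat Qinf <= rho%:E ->
        Jupper rho = Jstar rho /\ Jstar rho = Jlower rho].
Proof.
move=> XXi Phat saa ro Xcl Xcv _ Xicl _ ell_cc ell_usc g_cc _ Xi_xihat d_metric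
  d_lsc [x0X x0_opt] saa_fin [xinfX xinf_opt] ro_fin saa_coer _ QinfXi Qinf_opt
  Jstar Jupper Jlower.
have Ycl : closed XXi by exact: closed_feasible.
have Ycv : plain_convex_set XXi by exact: convex_feasible.
have YX : XXi `<=` X by move=> x [].
have segY : segment x0 xinf `<=` XXi.
  by move=> _ [l _ <-]; apply: Ycv => //; apply/andP; split.
have PXi : probabilities_on Xi Phat by exact: probabilities_on_empirical.
have [saaNy _] := expect_empirical_gtNy_convex Xicl Xi_xihat ell_cc ell_usc.
have dualP : saa x0 <= dual_objective Xi ell XXi Phat.
  by apply: le_ereal_inf_tmp => _ [x Yx <-]; exact: x0_opt.
split.
- split.
  + exact: primal_value_nondecreasing.
  + exact: primal_value_nondecreasing.
  + exact: lower_bound_nondecreasing.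
- split.
  + by apply: (primal_value_concave Xicl ell_usc) => // x /YX; exact: saaNy.
  + by apply: (primal_value_concave Xicl ell_usc) => // x /segY/YX//; exact: saaNy.
  + apply: (lower_bound_concave Xicl ell_usc) => //.
    by apply: lt_le_trans dualP; apply: saaNy; exact: YX.
move=> rho rhoP.
have weak_duality : Jlower rho <= Jstar rho.
  apply: ge_ereal_sup => _ [B [_ BB] <-]; apply: le_ereal_inf_tmp => _ [x Yx <-].
  apply: (@le_trans _ _ (expect Xi B (ell x))).
    by apply: ereal_inf_lbound; exists x.
  by apply: ereal_sup_ubound; exists B.
have restriction : Jstar rho <= Jupper rho.
  by apply: le_ereal_inf => _ [x /segY Yx <-]; exists x.
(* Weak duality and restriction give [Jlower <= Jstar <= Jupper]; a constant above [Jupper] and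
   below [Jlower] closes the cycle. It is the sampled optimum at radius zero and the robust optimum
   for large radii. *)
suff [c Jc cJ] : exists2 c, Jupper rho <= c & c <= Jlower rho.
  have JJ : Jupper rho <= Jlower rho := le_trans Jc cJ.
  split; apply/eqP; rewrite eq_le.
    by rewrite restriction (le_trans JJ).
  by rewrite weak_duality (le_trans restriction).
have segx0 : segment x0 xinf x0.
  by exists (Itv01 (lexx 0%R) ler01) => //=; rewrite subr0 scale1r scale0r addr0.
have segxinf : segment x0 xinf xinf.
  by exists (Itv01 ler01 (lexx 1%R)) => //=; rewrite subrr scale1r scale0r add0r.
case: rhoP => [->|Wrho].
  exists (saa x0).
    apply: le_trans (ereal_inf_lbound _) _; first by exists x0.
    apply: ge_ereal_sup => _ [Q [QXi W0] <-].
    rewrite (eq_expect Xi (Q' := Phat))// => A mA.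
    exact: (wasserstein_empirical_eq0 d_metric Xicl Xi_xihat d_lsc QXi W0 mA).
  apply: le_trans dualP _; apply: ereal_sup_ubound.
  apply: (@mixture_in_lower_bound _ _ _ _ ell d Xicl Phat _ _ Qinf
    (Itv01 (lexx 0%R) ler01) Phat).
    by move=> A _; rewrite mixture0.
  exact: wasserstein_ball_center.
exists (ro xinf).
  apply: le_trans (ereal_inf_lbound _) _; first by exists xinf.
  by apply: ge_ereal_sup => _ [Q [QXi _] <-]; exact: expect_le_worst_case.
apply: (@le_trans _ _ (dual_objective Xi ell XXi Qinf)); last first.
  apply: ereal_sup_ubound.
  apply: (@mixture_in_lower_bound _ _ _ _ ell d Xicl Phat _ _ Qinf
    (Itv01 ler01 (lexx 1%R)) Qinf).
    by move=> A _; rewrite mixture1.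
  by split=> //; apply: le_trans (wasserstein_sym_le d_metric _ _) _.
have /fineK roE := ro_fin; have /fineK saaE := saa_fin.
(* It remains to compare [ro xinf] with the dual value of [Qinf], which dominates that of the
   [e]-optimal [Q] obtained next. *)
apply/lee_addgt0Pr => e e0.
have [|||Q QXi HQ] := @robust_minimax R n k N X XXi Xi ell xihat Ycl Ycv YX Xicl
  Xi_xihat ell_cc ell_usc xinf (fine (ro xinf)) (fine (saa x0)) Xcv saa_coer _
  xinfX _ _ e e0.
- by move=> x Yx; rewrite saaE; exact: x0_opt.
- by rewrite roE.
- by move=> x Yx; rewrite roE; exact: xinf_opt.
apply: (@le_trans _ _ (dual_objective Xi ell XXi Q + e%:E)).
  rewrite -leeBlDr// -roE -EFinB; apply: le_ereal_inf_tmp => _ [x Yx <-].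
  exact: HQ.
by rewrite leeD2r// Qinf_opt.
Qed.
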